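(* Let $N\ge 2$ and let $c(i,j)$, $1\le i<j\le N$, be real numbers, with associated partition function $\mathcal{Z}(\beta)$, critical inverse temperatures $\beta^\pm$, and maximal nest sizes $\kappa^\pm$. For either choice of sign $\pm$, provided that $\beta^\pm$ is finite, $$-\frac1N\log\mathcal{Z}(\beta)=\frac{\kappa^\pm}{N}\log|\beta-\beta^\pm|+\mathcal{O}(1)\quad\text{as }\beta\to\beta^\pm,\ \beta\in(\beta^-,\beta^+).$$
   Context: $\mathbb{S}^2$ is the unit sphere, $d$ the chordal distance, $\mathrm{d}V$ the rotation-invariant volume form normalized to be a probability measure. The partition function is $\mathcal{Z}(\beta)=\int_{(\mathbb{S}^2)^N}\prod_{i<j}d(p_i,p_j)^{2c(i,j)\beta}\,\mathrm{d}V^{\otimes N}$. Set $$T^+=-\min_S\frac{\sum_{i,j\in S:\,i<j}c(i,j)}{|S|-1},\qquad T^-=-\max_S\frac{\sum_{i,j\in S:\,i<j}c(i,j)}{|S|-1},$$ where $S$ ranges over all subsets of $\{1,\dots,N\}$ with $|S|\ge 2$. The critical inverse temperatures are $\beta^-=1/T^-$ if $T^-<0$ and $-\infty$ otherwise; $\beta^+=1/T^+$ if $T^+>0$ and $\infty$ otherwise. The partition function is finite precisely for $\beta\in(\beta^-,\beta^+)$. $G^+$ (respectively $G^-$) is the set of subsets $S\subseteq\{1,\dots,N\}$ with $|S|\ge2$ that attain the minimum defining $T^+$ (respectively the maximum defining $T^-$). A collection $K$ of distinct subsets of $\{1,\dots,N\}$ is a nest if any two elements $S,S'\in K$ satisfy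 $S\subset S'$, $S'\subset S$, or $S\cap S'=\emptyset$. $\kappa^+$ (respectively $\kappa^-$) is the maximal cardinality of a nest consisting of elements of $G^+$ (respectively $G^-$). *)

(* Defs.v *)
From HB Require Import structures.
From mathcomp Require Import all_boot all_order all_algebra.
From mathcomp Require Import all_classical all_reals all_analysis.

Set Implicit Arguments.
Unset Strict Implicit.
Unset Printing Implicit Defensive.
Import Order.TTheory GRing.Theory Num.Theory.
Import numFieldNormedType.Exports.
Local Open Scope classical_set_scope.
Local Open Scope ring_scope.

(* The N-fold product of a probability measure, on the product sigma-algebra
   of N.-tuple T: P^(N+1) is the image of P \x P^N under (x, t) |-> x :: t.   *)
Section product_power.
Context d (T : measurableType d) (R : realType).

Definition tuple_cons n (x : T * n.-tuple T) : n.+1.-tuple T :=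
  [the n.+1.-tuple T of x.1 :: x.2].

Lemma measurable_tuple_cons n : measurable_fun setT (@tuple_cons n).
Proof. exact: measurable_cons measurable_fst measurable_snd. Qed.

HB.instance Definition _ n :=
  isMeasurableFun.Build _ _ _ _ (@tuple_cons n) (@measurable_tuple_cons n).

Fixpoint product_power (P : probability T R) n : probability (n.-tuple T) R :=
  match n with
  | 0 => dirac [tuple]
  | n'.+1 => distribution (P \x product_power P n')%E (@tuple_cons n')
  end.

End product_power.

Section sphere.
Context {R : realType}.

Definition unit_sphere : set (3.-tuple R) :=
  [set p | \sum_(k < 3) tnth p k ^+ 2 = 1].

Definition chordal_dist (p q : 3.-tuple R) : R :=
  Num.sqrt (\sum_(k < 3) (tnth p k - tnth q k) ^+ 2).

Definition rotation (Q : 'M[R]_3) : Prop := Q *m Q^T = 1%:M /\ \det Q = 1.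

Definition rotate (Q : 'M[R]_3) (p : 3.-tuple R) : 3.-tuple R :=
  [tuple \sum_(k < 3) Q i k * tnth p k | i < 3].

(* By uniqueness of the invariant probability measure on the homogeneous space
   SO(3)/SO(2), this characterizes the normalized area measure of the sphere,
   seen as a measure on R^3.                                                  *)
Definition invariant_sphere_probability (mu : probability (3.-tuple R) R) :=
  mu unit_sphere = 1%E /\
  forall Q, rotation Q -> forall A, measurable A -> mu (rotate Q @^-1` A) = mu A.

End sphere.

Section critical_temperatures.
Context {R : realType} {N : nat} (c : 'I_N -> 'I_N -> R).
Implicit Types (S : {set 'I_N}) (G K : {set {set 'I_N}}).

Definition interaction_ratio S : R :=
  (\sum_(i in S) \sum_(j in S | (i < j)%N) c i j) / (#|S|%:R - 1).

(* The default value of the extremum is the one at the full set, which is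
   admissible as soon as N >= 2.                                              *)
Definition min_ratio : R :=
  \big[Num.min/interaction_ratio [set: 'I_N]%SET]_(S : {set 'I_N} | (2 <= #|S|)%N)
    interaction_ratio S.
Definition max_ratio : R :=
  \big[Num.max/interaction_ratio [set: 'I_N]%SET]_(S : {set 'I_N} | (2 <= #|S|)%N)
    interaction_ratio S.

Definition T_plus : R := - min_ratio.
Definition T_minus : R := - max_ratio.

Definition beta_plus : \bar R := if 0 < T_plus then (T_plus^-1)%:E else +oo%E.
Definition beta_minus : \bar R := if T_minus < 0 then (T_minus^-1)%:E else -oo%E.

Definition G_plus : {set {set 'I_N}} :=
  [set S : {set 'I_N} | (2 <= #|S|)%N && (interaction_ratio S == min_ratio)]%SET.
Definition G_minus : {set {set 'I_N}} :=
  [set S : {set 'I_N} | (2 <= #|S|)%N && (interaction_ratio S == max_ratio)]%SET.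

Definition nest K : bool :=
  [forall S in K, forall S' in K,
    [|| S \subset S', S' \subset S | [disjoint S & S']]].

Definition max_nest_size G : nat :=
  \max_(K : {set {set 'I_N}} | (K \subset G) && nest K) #|K|.

Definition kappa_plus : nat := max_nest_size G_plus.
Definition kappa_minus : nat := max_nest_size G_minus.

End critical_temperatures.

(* The value of the integrand at configurations with coinciding points
   (where 0 `^ x = 0 even for x < 0) is irrelevant: they form a null set.     *)
Definition partition_function {R : realType} {N : nat}
    (mu : probability (3.-tuple R) R) (c : 'I_N -> 'I_N -> R) (b : R) : \bar R :=
  (\int[product_power mu N]_(p in [set p | forall i, unit_sphere (tnth p i)])
    (\prod_(i < N) \prod_(j < N | (i < j)%N)
       chordal_dist (tnth p i) (tnth p j) `^ (2 * c i j * b))%:E)%E.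

(* Main.v *)
(* Attach to a configuration of distinct points the clusterings at the scales
   q^k: the equivalence relations E_1, E_2, ... generated by "at distance at
   most 2 q^k".  They form a decreasing sequence (a flag), and up to constants
   the points i, j are at distance q^n(i,j), where n(i,j) counts the k with
   (i,j) in E_k.  Placing the points one after the other, and using that balls
   of radius r have mass of order r^2, the configurations with flag (E_k) have
   mass of order q^(2 \sum_k rank E_k).  Hence their contribution to Z(b) is of
   order \prod_k q^(energy b E_k), where the energy of E is the sum over its
   classes S of 2 (|S| - 1) (1 + b * ratio S).

   So Z(b) is comparable with the sum F(E) of these products over all flags
   below the full relation E, where
     F(E) = \sum_(E' included in E) q^(energy b E') F(E').
   Each E contributes a factor (1 - q^(energy b E))^-1, which remains bounded as
   b tends to beta_plus, unless all the nontrivial classes of E belong to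
   G_plus, in which case it is of order 1/eps with eps = 1 - b * T_plus.  Along a
   chain of relations of the latter kind, each step produces a new class, and
   the classes form a nest; conversely the relations generated by the initial
   segments of a nest, ordered by cardinality, are of that kind.  Hence F is of
   order eps^-kappa_plus.  The statement at beta_minus follows by changing the
   signs of c and b. *)

Require Import Defs.
From mathcomp Require Import all_boot all_order all_algebra.
From mathcomp Require Import all_classical all_reals all_analysis.
From mathcomp Require Import measurable_realfun ring lra zify.
Import Order.TTheory GRing.Theory Num.Theory.
Import numFieldNormedType.Exports.
Local Open Scope classical_set_scope.
Local Open Scope ring_scope.

Set Implicit Arguments.
Unset Strict Implicit.
Unset Printing Implicit Defensive.

(** * Equivalence relations, flags and nests *)

Section equivalences.
Import fintype finset bigop.
Variable N : nat.
Implicit Types (E : {set 'I_N * 'I_N}) (S B : {set 'I_N})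
  (K G : {set {set 'I_N}}) (s : seq {set 'I_N * 'I_N}).

(** Relations are finite sets of pairs, so that refinement is [\subset] and sums over all
    equivalence relations are finite sums. *)
Definition is_equiv E : bool :=
  [&& [forall i, (i, i) \in E],
      [forall i, forall j, ((i, j) \in E) ==> ((j, i) \in E)] &
      [forall i, forall j, forall k,
         ((i, j) \in E) && ((j, k) \in E) ==> ((i, k) \in E)]].

Lemma is_equivP E : reflect
  [/\ forall i, (i, i) \in E, forall i j, (i, j) \in E -> (j, i) \in E &
      forall i j k, (i, j) \in E -> (j, k) \in E -> (i, k) \in E]
  (is_equiv E).
Proof.
apply: (iffP and3P) => [[/forallP h1 /'forall_forallP h2 /'forall_'forall_forallP h3]|].
  split=> [//|i j ij|i j k ij jk]; first exact: (implyP (h2 i j)).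
  by apply: (implyP (h3 i j k)); rewrite ij jk.
move=> [h1 h2 h3]; split; first exact/forallP.
  by apply/'forall_forallP => i j; apply/implyP/h2.
by apply/'forall_'forall_forallP => i j k; apply/implyP => /andP[]; apply: h3.
Qed.

Definition diag_rel : {set 'I_N * 'I_N} := [set p | p.1 == p.2]%SET.

Lemma is_equiv_setT : is_equiv [set: 'I_N * 'I_N]%SET.
Proof. by apply/is_equivP; split=> *; rewrite !inE. Qed.

Lemma is_equiv_diag : is_equiv diag_rel.
Proof.
apply/is_equivP; split=> [i|i j|i j k]; rewrite !inE //=.
  by rewrite eq_sym.
by move=> /eqP ->.
Qed.

Lemma diag_sub_equiv E : is_equiv E -> diag_rel \subset E.
Proof.
by move=> /is_equivP[h _ _]; apply/subsetP => -[i j]; rewrite inE /= => /eqP ->.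
Qed.

Definition rel_class E i : {set 'I_N} := [set j | (i, j) \in E]%SET.

(** The points that are not the largest of their class, so N minus the number of classes. When
    points are placed from the last index to the first, these are the ones put near a point already
    placed. *)
Definition rank_equiv E : nat :=
  \sum_(i < N) [exists j : 'I_N, (i < j)%N && ((i, j) \in E)].

Definition blocks E : {set {set 'I_N}} :=
  equivalence_partition (fun i j => (i, j) \in E) [set: 'I_N]%SET.

Section partition_of_equiv.
Variables (E : {set 'I_N * 'I_N}) (eqE : is_equiv E).

Let Erefl i : (i, i) \in E. Proof. by case/is_equivP: eqE. Qed.
Let Esym i j : (i, j) \in E -> (j, i) \in E.
Proof. by case/is_equivP: eqE => _ + _; apply. Qed.
Let Etrans i j k : (i, j) \in E -> (j, k) \in E -> (i, k) \in E.
Proof. by case/is_equivP: eqE => _ _; apply. Qed.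

Lemma blocks_partition : finset.partition (blocks E) [set: 'I_N]%SET.
Proof.
apply: equivalence_partitionP => i j k _ _ _; split => // ij.
by apply/idP/idP => [ik|jk]; [exact: Etrans (Esym ij) ik|exact: Etrans ij jk].
Qed.

Lemma mem_blocks B : B \in blocks E -> exists i, B = rel_class E i.
Proof.
case/imsetP => i _ ->; exists i.
by apply/setP => j; rewrite !inE.
Qed.

Lemma rel_class_blocks i : rel_class E i \in blocks E.
Proof.
by apply/imsetP; exists i => //; apply/setP => j; rewrite !inE.
Qed.

Lemma blocks_relE B i j : B \in blocks E -> i \in B -> ((i, j) \in E) = (j \in B).
Proof.
move=> /mem_blocks[k ->]; rewrite !inE => ki.
by apply/idP/idP => [ij|kj]; [exact: Etrans ki ij|exact: Etrans (Esym ki) kj].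
Qed.

Lemma big_blocks (R : nmodType) (F : 'I_N -> R) :
  \sum_(i < N) F i = \sum_(B in blocks E) \sum_(i in B) F i.
Proof.
rewrite -(set_partition_big _ blocks_partition) /=.
by apply: eq_bigl => i; rewrite inE.
Qed.

Lemma card_block_gt0 B : B \in blocks E -> (0 < #|B|)%N.
Proof.
move=> /mem_blocks[i ->]; rewrite card_gt0; apply/set0Pn; exists i.
by rewrite inE.
Qed.

(** In each class, exactly the maximum has no larger partner. *)
Lemma rank_equivE : rank_equiv E = (\sum_(B in blocks E) #|B|.-1)%N.
Proof.
rewrite /rank_equiv (big_blocks (fun i => _ : nat)).
apply: eq_bigr => B BE.
have [i0 i0B] : exists i, i \in B by apply/set0Pn; rewrite -card_gt0 card_block_gt0.
pose m := [arg max_(i > i0 in B) (i : nat)].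
have [mB mmax] : m \in B /\ forall j, j \in B -> (j <= m)%N.
  by rewrite /m; case: arg_maxnP.
rewrite (bigD1 m) //= (_ : [exists _, _] = false) ?add0n; last first.
  apply/negbTE/existsPn => j; apply/negP => /andP[mj].
  by rewrite (blocks_relE _ BE mB) => /mmax; rewrite leqNgt mj.
rewrite (eq_bigr (fun=> 1%N)); last first.
  move=> i /andP[iB im]; apply/eqP; rewrite eqb1; apply/existsP; exists m.
  rewrite (blocks_relE _ BE iB) mB andbT ltn_neqAle mmax// andbT.
  by apply: contra im => /eqP/val_inj ->.
rewrite sum1_card (cardD1 m B) mB /=; apply: eq_card => i.
by rewrite !inE unfold_in /= andbC.
Qed.

Lemma rank_equiv_le : (rank_equiv E <= N)%N.
Proof.
rewrite /rank_equiv -[leqRHS]card_ord -sum1_card; apply: leq_sum => i _.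
exact: leq_b1.
Qed.

Lemma nontrivial_block : E != diag_rel ->
  exists2 B, B \in blocks E & (2 <= #|B|)%N.
Proof.
move=> nE; have : ~~ (E \subset diag_rel).
  by apply: contra nE => sE; rewrite finset.eqEsubset sE diag_sub_equiv.
case/subsetPn => -[i j] ij; rewrite inE /= => nij.
exists (rel_class E i); first exact: rel_class_blocks.
by apply/card_gt1P; exists i, j; rewrite !inE nij ij Erefl.
Qed.

End partition_of_equiv.

(** Decreasing sequences of exactly [M] relations, repetitions allowed: the k-th entry is the
    clustering at the k-th scale. *)
Fixpoint flags M E : seq (seq {set 'I_N * 'I_N}) :=
  if M is M'.+1 then
    [seq E' :: s | E' <- enum [pred E' | is_equiv E' && (E' \subset E)],
                   s <- flags M' E']
  else [:: [::]].

(** As a flag decreases, this count is the last index at which i and j are still together. *)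
Definition level s (i j : 'I_N) : nat := count (fun E => (i, j) \in E) s.

Lemma mem_flagsS M E E' s : (E' :: s \in flags M.+1 E) =
  [&& is_equiv E', E' \subset E & s \in flags M E'].
Proof.
apply/allpairsPdep/idP => [[E1 [s1 [+ + [-> ->]]]]|/and3P[h1 h2 h3]].
  by rewrite mem_enum inE /= => /andP[-> ->] ->.
by exists E', s; split=> //; rewrite mem_enum inE /= h1 h2.
Qed.

Lemma flagsS_cons M E s : s \in flags M.+1 E -> exists E' s', s = E' :: s'.
Proof. by case/allpairsPdep => E1 [s1 [_ _ ->]]; exists E1, s1. Qed.

Lemma flags_uniq M E : uniq (flags M E).
Proof.
elim: M E => [//|M IH] E; apply: allpairs_uniq_dep => //.
- exact: enum_uniq.
- by move=> [E1 s1] [E2 s2] _ _ /= [-> ->].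
Qed.

Lemma flags_equiv M E s : s \in flags M E -> all is_equiv s.
Proof.
elim: M E s => [|M IH] E s; first by rewrite inE => /eqP ->.
move=> sf; have [E' [s' es]] := flagsS_cons sf; move: sf; rewrite {}es.
by rewrite mem_flagsS /= => /and3P[-> _ /IH ->].
Qed.

Lemma flags_sub M E s : s \in flags M E -> all (fun E' => E' \subset E) s.
Proof.
elim: M E s => [|M IH] E s; first by rewrite inE => /eqP ->.
move=> sf; have [E' [s' es]] := flagsS_cons sf; move: sf; rewrite {}es.
rewrite mem_flagsS /= => /and3P[_ sE /IH /allP h]; rewrite sE /=.
by apply/allP => E1 /h sE1; apply: subset_trans sE.
Qed.

Lemma size_flags M E s : s \in flags M E -> size s = M.
Proof.
elim: M E s => [|M IH] E s; first by rewrite inE => /eqP ->.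
move=> sf; have [E' [s' es]] := flagsS_cons sf; move: sf; rewrite {}es.
by rewrite mem_flagsS /= => /and3P[_ _ /IH ->].
Qed.

Lemma level_eq0 M E s i j : s \in flags M E -> (i, j) \notin E -> level s i j = 0%N.
Proof.
move=> /flags_sub/allP h nij; apply/eqP; rewrite -leqn0 leqNgt -has_count.
by apply/hasPn => E' /h /subsetP sE; apply: contra nij => /sE.
Qed.

Lemma level_refl M E s i : s \in flags M E -> level s i i = M.
Proof.
move=> sf; rewrite -(size_flags sf); apply/eqP; rewrite -all_count.
by apply/allP => E' /(allP (flags_equiv sf))/is_equivP[].
Qed.

Lemma level_sym M E s i j : s \in flags M E -> level s i j = level s j i.
Proof.
move=> sf; apply: eq_in_count => E' /(allP (flags_equiv sf))/is_equivP[_ h _].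
by apply/idP/idP; apply: h.
Qed.

(** If one of the two pairs is not in the first relation, its level is 0; otherwise transitivity
    puts all three pairs in it and the induction goes on with the tail. *)
Lemma level_ultrametric M E s i j k : s \in flags M E ->
  (minn (level s i j) (level s j k) <= level s i k)%N.
Proof.
elim: M E s => [|M IH] E s; first by rewrite inE => /eqP ->.
move=> sf; have [E' [s' es]] := flagsS_cons sf; move: sf; rewrite {}es.
rewrite mem_flagsS => /and3P[eE _ sf].
have [_ _ tr] := is_equivP _ eE; rewrite /level /= -!/(level _ _ _).
have [ij|nij] := boolP ((i, j) \in E'); last first.
  by rewrite (level_eq0 sf nij) min0n.
have [jk|njk] := boolP ((j, k) \in E'); last first.
  by rewrite (level_eq0 sf njk) minn0.
by rewrite (tr _ _ _ ij jk) /= !add1n minnSS ltnS; apply: IH sf.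
Qed.

(** The first relation consists of the pairs of positive level. This makes the sets of
    configurations attached to distinct flags disjoint. *)
Lemma level_inj M E s1 s2 : s1 \in flags M E -> s2 \in flags M E ->
  (forall i j, level s1 i j = level s2 i j) -> s1 = s2.
Proof.
elim: M E s1 s2 => [|M IH] E s1 s2.
  by rewrite !inE => /eqP -> /eqP ->.
move=> sf1 sf2.
have [E1 [s1' es1]] := flagsS_cons sf1; have [E2 [s2' es2]] := flagsS_cons sf2.
move: sf1 sf2; rewrite {}es1 {}es2 !mem_flagsS => /and3P[_ _ f1] /and3P[_ _ f2].
rewrite /level /= => h.
have E12 : E1 = E2.
  apply/setP => -[i j]; move: (h i j); rewrite -!/(level _ _ _).
  have [//|n1] := boolP ((i, j) \in E1); have [//|n2] := boolP ((i, j) \in E2) => //.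
    by rewrite (level_eq0 f2 n2).
  by rewrite (level_eq0 f1 n1).
rewrite -E12 in f2 h *; congr cons; apply: IH f1 f2 _ => i j.
by move/addnI: (h i j).
Qed.

(** The point i counts in the rank of a relation as long as some j > i is still with it, hence in
    the first [\max_j level s i j] relations. The right side is the exponent produced by placing
    points one after the other. *)
Lemma flag_rankE M E s : s \in flags M E ->
  (\sum_(E' <- s) rank_equiv E')%N =
  (\sum_(i < N) \max_(j < N | (i < j)%N) level s i j)%N.
Proof.
elim: M E s => [|M IH] E s.
  rewrite inE => /eqP ->; rewrite big_nil big1// => i _.
  by rewrite big1.
move=> sf; have [E' [s' es]] := flagsS_cons sf; move: sf; rewrite {}es.
rewrite mem_flagsS big_cons => /and3P[_ _ sf]; rewrite (IH _ _ sf).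
rewrite /rank_equiv -big_split /=; apply: eq_bigr => i _.
apply/eqP; rewrite eqn_leq; apply/andP; split.
  case: existsP => [[j0 /andP[ij0 ij0E]]|_]; last first.
    rewrite add0n; apply/bigmax_leqP => j ij.
    by rewrite (bigop.bigmax_sup j)// /level /= leq_addl.
  have : (0 < #|[pred j : 'I_N | (i < j)%N]|)%N by apply/card_gt0P; exists j0.
  move=> /(eq_bigmax_cond (level s' i))[j]; rewrite inE => ij mE.
  have -> : \max_(j < N | (i < j)%N) level s' i j = level s' i j.
    by rewrite -mE; apply: eq_bigl => k; rewrite inE.
  have [ijE|nijE] := boolP ((i, j) \in E').
    by rewrite (bigop.bigmax_sup j)// /level /= ijE.
  by rewrite (level_eq0 sf nijE) (bigop.bigmax_sup j0)// /level /= ij0E leq_addr.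
apply/bigmax_leqP => j ij; rewrite /level /=; apply: leq_add.
  have [ijE|//] := boolP ((i, j) \in E'); rewrite lt0b; apply/existsP.
  by exists j; rewrite ij.
by rewrite (bigop.bigmax_sup j).
Qed.

Lemma sum_levelE (R : pzRingType) s (e : 'I_N -> 'I_N -> R) :
  \sum_(i < N) \sum_(j < N | (i < j)%N) (level s i j)%:R * e i j =
  \sum_(E <- s) \sum_(i < N) \sum_(j < N | (i < j)%N && ((i, j) \in E)) e i j.
Proof.
elim: s => [|E s IH].
  by rewrite big_nil big1// => i _; rewrite big1// => j _; rewrite mul0r.
rewrite big_cons -IH -big_split /=; apply: eq_bigr => i _.
rewrite big_mkcondr -big_split /=; apply: eq_bigr => j _.
by rewrite natrD mulrDl; case: ifP => _; rewrite ?mul1r ?mul0r.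
Qed.

(** * Nests whose members lie inside the classes of a relation *)

Section nests.
Variable G : {set {set 'I_N}}.

Definition subnest E : pred {set {set 'I_N}} := fun K =>
  [&& K \subset G, nest K & [forall S in K, finset.setX S S \subset E]].

(** The power of 1/eps that bounds the sum over the flags below [E]. *)
Definition nest_depth E : nat := \max_(K | subnest E K) #|K|.

Lemma nestP K : reflect {in K &, forall S S',
  [|| S \subset S', S' \subset S | [disjoint S & S']]} (nest K).
Proof.
apply: (iffP forall_inP) => [h S S' SK S'K|h S SK].
  exact: (forall_inP (h S SK)).
by apply/forall_inP => S' S'K; apply: h.
Qed.

Lemma subnestP E K : reflect
  [/\ K \subset G, nest K & forall S, S \in K -> finset.setX S S \subset E]
  (subnest E K).
Proof.
apply: (iffP and3P) => -[h1 h2 h3]; split=> //.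
  by move=> S SK; exact: (forall_inP h3).
exact/forall_inP.
Qed.

Lemma nest_depth_max E : (nest_depth E <= max_nest_size G)%N.
Proof.
apply/bigmax_leqP => K /subnestP[KG nK _].
by rewrite /max_nest_size (bigop.bigmax_sup K)// KG.
Qed.

Lemma nest_depth_mono E E' : E' \subset E -> (nest_depth E' <= nest_depth E)%N.
Proof.
move=> sE; apply/bigmax_leqP => K /subnestP[KG nK KE'].
rewrite /nest_depth (bigop.bigmax_sup K)//; apply/subnestP; split=> // S /KE' h.
exact: subset_trans sE.
Qed.

(** A largest nest for [E'] is extended by the [E]-class [B] of a pair separated by [E']. The class
    is new because its square is not inside [E'], and each member of the nest lies in one class of
    [E], hence inside [B] or disjoint from it. *)
Lemma nest_depth_lt E E' : is_equiv E -> is_equiv E' -> E' \proper E ->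
  (forall B, B \in blocks E -> (2 <= #|B|)%N -> B \in G) ->
  (nest_depth E' < nest_depth E)%N.
Proof.
move=> eE eE' /properP[sE [[i j] ijE nijE']] crit.
have [refl _ _] := is_equivP _ eE.
pose B := rel_class E i.
have BE : B \in blocks E by exact: rel_class_blocks.
have iB : i \in B by rewrite inE.
have jB : j \in B by rewrite inE.
have BG : B \in G.
  apply: crit => //; apply/card_gt1P; exists i, j; split=> //.
  apply: contra nijE' => /eqP <-.
  by have [] := is_equivP _ eE'.
have : exists K, subnest E' K by
  exists finset.set0; apply/subnestP; split; rewrite ?finset.sub0set//;
  [apply/nestP => S S' | move=> S]; rewrite inE.
move=> /card_gt0P/eq_bigmax_cond => /(_ (fun K => #|K|))[K /subnestP[KG nK KE'] mE].
have -> : nest_depth E' = #|K| by rewrite -mE.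
have BK : B \notin K.
  apply: contra nijE' => /KE'/subsetP; apply.
  by rewrite finset.in_setX iB.
have KB S : S \in K -> (S \subset B) || [disjoint S & B].
  move=> SK; case: (boolP [disjoint S & B]) => [|/pred0Pn[x /= /andP[xS xB]]].
    by rewrite orbT.
  rewrite orbF; apply/subsetP => y yS; rewrite -(blocks_relE eE _ BE xB).
  by apply: (subsetP sE); apply: (subsetP (KE' _ SK)); rewrite finset.in_setX xS.
rewrite /nest_depth (bigop.bigmax_sup (B |: K)%SET)//; last by rewrite cardsU1 BK.
apply/subnestP; split.
- by rewrite finset.subUset finset.sub1set BG.
- apply/nestP => S S'; rewrite !inE => /predU1P[->|SK] /predU1P[->|S'K].
  + by rewrite subxx.
  + by have /orP[->|] := KB _ S'K; rewrite ?orbT// disjoint_sym => ->; rewrite !orbT.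
  + by have /orP[->//|->] := KB _ SK; rewrite !orbT.
  + exact: (nestP _ nK).
- move=> S; rewrite !inE => /predU1P[->|/KE' h]; last exact: subset_trans sE.
  apply/subsetP => -[x y]; rewrite finset.in_setX /= => /andP[xB yB].
  by rewrite (blocks_relE eE _ BE xB).
Qed.

End nests.

(** * The equivalence relation generated by a nest *)

Section equivalence_of_a_nest.

(** Two members of a nest that share a point are comparable, so this union of squares is already
    transitive; equality is added for the points outside the nest. *)
Definition nest_rel K : {set 'I_N * 'I_N} :=
  [set p | (p.1 == p.2) ||
           [exists S : {set 'I_N}, [&& S \in K, p.1 \in S & p.2 \in S]]]%SET.

Lemma nest_relP K i j : reflect
  (i = j \/ exists S, [/\ S \in K, i \in S & j \in S]) ((i, j) \in nest_rel K).
Proof.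
rewrite inE /=; apply: (iffP orP) => -[h|h].
- by left; apply/eqP.
- by right; have [S /and3P[]] := existsP h; exists S.
- by left; apply/eqP.
- by right; apply/existsP; case: h => S [*]; exists S; apply/and3P.
Qed.

Lemma nest_rel_equiv K : nest K -> is_equiv (nest_rel K).
Proof.
move=> /nestP nK; apply/is_equivP; split.
- by move=> i; apply/nest_relP; left.
- by move=> i j /nest_relP[->|[S [*]]]; apply/nest_relP; [left|right; exists S].
move=> i j k /nest_relP[->//|[S [SK iS jS]]] /nest_relP[<-|[S' [S'K jS' kS']]].
  by apply/nest_relP; right; exists S.
have /or3P[/subsetP SS'|/subsetP SS'|] := nK _ _ SK S'K.
- by apply/nest_relP; right; exists S'; split=> //; apply: SS'.
- by apply/nest_relP; right; exists S; split=> //; apply: SS'.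
- by rewrite finset.disjoints_subset => /subsetP/(_ _ jS); rewrite inE jS'.
Qed.

(** The class of i is the largest member of the nest containing i. *)
Lemma nest_rel_class K i S0 : nest K -> S0 \in K -> i \in S0 ->
  rel_class (nest_rel K) i \in K.
Proof.
move=> nK S0K iS0.
pose S := [arg max_(S > S0 | (S \in K) && (i \in S)) #|S|].
have [/andP[SK iS] Smax] : ((S \in K) && (i \in S)) /\
    forall S', (S' \in K) && (i \in S') -> (#|S'| <= #|S|)%N.
  by rewrite /S; case: arg_maxnP => //; rewrite S0K.
suff -> : rel_class (nest_rel K) i = S by [].
apply/setP => x; rewrite inE; apply/nest_relP/idP => [[<-//|]|xS]; last first.
  by right; exists S.
move=> [S' [S'K iS' xS']]; have /or3P[SS'|/subsetP SS'|] := (nestP _ nK) _ _ SK S'K.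
- have /eqP -> : S == S' by rewrite finset.eqEcard SS' Smax// S'K.
  by [].
- exact: SS'.
- by rewrite finset.disjoints_subset => /subsetP/(_ _ iS); rewrite inE iS'.
Qed.

Lemma nest_rel_block K B : nest K ->
  B \in blocks (nest_rel K) -> (2 <= #|B|)%N -> B \in K.
Proof.
move=> nK BE /card_gt1P[i [j [iB jB ij]]].
have eE := nest_rel_equiv nK.
have -> : B = rel_class (nest_rel K) i.
  by apply/setP => k; rewrite inE (blocks_relE eE _ BE iB).
have : (i, j) \in nest_rel K by rewrite (blocks_relE eE _ BE iB).
case/nest_relP => [/eqP|[S [SK iS _]]]; first by rewrite (negbTE ij).
exact: nest_rel_class SK iS.
Qed.

Lemma nestD1 K S : nest K -> nest (K :\ S)%SET.
Proof.
move=> /nestP nK; apply/nestP => S1 S2.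
by rewrite !inE => /andP[_ h1] /andP[_ h2]; apply: nK.
Qed.

(** If the relation did not shrink, [S] would lie in a single class of the smaller relation. That
    class is a member of the nest other than [S], of cardinality at most that of [S], hence equal to
    [S]: a contradiction. *)
Lemma nest_rel_proper K S : nest K -> S \in K -> (2 <= #|S|)%N ->
  (forall S', S' \in K -> (#|S'| <= #|S|)%N) ->
  nest_rel (K :\ S)%SET \proper nest_rel K.
Proof.
move=> nK SK S2 Smax; have nK' := nestD1 S nK.
apply/properP; split.
  apply/subsetP => -[i j] /nest_relP[->|[S' [+ iS' jS']]].
    by apply/nest_relP; left.
  by rewrite in_setD1 => /andP[_ S'K]; apply/nest_relP; right; exists S'.
have /card_gt1P[i [j [iS jS ij]]] := S2.
apply: contrapT => h; have {}h x y : x \in S -> y \in S -> (x, y) \in nest_rel (K :\ S)%SET.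
  move=> xS yS; apply/negPn/negP => nxy; apply: h; exists (x, y) => //.
  by apply/nest_relP; right; exists S.
have := h i j iS jS; case/nest_relP => [/eqP|[S0 [S0K iS0 _]]].
  by rewrite (negbTE ij).
have := nest_rel_class nK' S0K iS0; rewrite in_setD1 => /andP[+ CK].
suff -> : rel_class (nest_rel (K :\ S)%SET) i = S by rewrite eqxx.
apply/esym/eqP; rewrite finset.eqEcard Smax// andbT.
by apply/subsetP => x xS; rewrite inE h.
Qed.

End equivalence_of_a_nest.

End equivalences.

(** * Sums over flags of clusterings *)

Section flag_sums.
Import fintype finset bigop.
Variables (R : realType) (N : nat).
Implicit Types (E : {set 'I_N * 'I_N}) (w : {set 'I_N * 'I_N} -> R).

(** The recursion for F(E), truncated to flags of length [M]. *)
Fixpoint flag_sum w M E : R :=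
  if M is M'.+1 then
    \sum_(E' : {set 'I_N * 'I_N} | is_equiv E' && (E' \subset E))
       w E' * flag_sum w M' E'
  else 1.

Lemma flag_sumE w M E :
  flag_sum w M E = \sum_(s <- flags M E) \prod_(E' <- s) w E'.
Proof.
elim: M E => [|M IH] E /=; first by rewrite big_seq1 big_nil.
rewrite big_allpairs_dep big_enum /=; apply: eq_bigr => E' _.
rewrite IH big_distrr /=; apply: eq_bigr => s _.
by rewrite big_cons.
Qed.

Section nonnegative_weights.
Variable w : {set 'I_N * 'I_N} -> R.
Hypothesis w_ge0 : forall E, 0 <= w E.

Lemma flag_sum_ge0 M E : 0 <= flag_sum w M E.
Proof.
by elim: M E => [//|M IH] E /=; apply: sumr_ge0 => E' _; rewrite mulr_ge0.
Qed.

Lemma flag_sum_mono M E E' : E' \subset E ->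
  flag_sum w M E' <= flag_sum w M E.
Proof.
case: M => [//|M] sE /=; rewrite [leRHS](bigID (fun F : {set 'I_N * 'I_N} => F \subset E')) /=.
rewrite ler_wpDr//.
  by apply: sumr_ge0 => F _; rewrite mulr_ge0// flag_sum_ge0.
rewrite le_eqVlt; apply/orP; left; apply/eqP/eq_bigl => F.
case: is_equiv => //=; apply/idP/andP => [FE'|[]//].
by rewrite FE' (subset_trans FE').
Qed.

(** Splitting off the term [E' = E] gives an affine recursion in [M] of ratio [w E], the source of
    the factor 1/(1 - w E). *)
Lemma flag_sumS M E : is_equiv E -> flag_sum w M.+1 E =
  w E * flag_sum w M E +
  \sum_(E' : {set 'I_N * 'I_N} | is_equiv E' && (E' \proper E))
     w E' * flag_sum w M E'.
Proof.
move=> eE /=; rewrite (bigD1 E) /=; last by rewrite eE subxx.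
congr (_ + _); apply: eq_bigl => E'; rewrite -andbA; congr (_ && _).
by rewrite finset.properEneq andbC.
Qed.

Lemma flag_sum_diag M : w (diag_rel N) = 1 -> flag_sum w M (diag_rel N) = 1.
Proof.
move=> w1; elim: M => [//|M IH].
rewrite flag_sumS ?is_equiv_diag// w1 mul1r IH big1 ?addr0// => E.
move=> /andP[eE]; rewrite fintype.properE => /andP[_].
by rewrite diag_sub_equiv.
Qed.

(** A flag can be prolonged by the diagonal relation, which costs nothing since its weight is 1. *)
Lemma flag_sum_incr M E : is_equiv E -> w (diag_rel N) = 1 ->
  flag_sum w M E <= flag_sum w M.+1 E.
Proof.
move=> eE w1; elim: M E eE => [|M IH] E eE /=.
  rewrite (bigD1 (diag_rel N)) /=; last by rewrite is_equiv_diag diag_sub_equiv.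
  rewrite w1 mul1r ler_wpDr//.
  by apply: sumr_ge0 => F _; rewrite mulr1.
apply: ler_sum => E' /andP[eE' _]; apply: ler_wpM2l => //; exact: IH.
Qed.

Lemma flag_sum_leq M M' E : is_equiv E -> w (diag_rel N) = 1 -> (M <= M')%N ->
  flag_sum w M E <= flag_sum w M' E.
Proof.
move=> eE w1 /subnK <-; elim: (M' - M)%N => [//|k IH].
by rewrite (le_trans IH)// addSn flag_sum_incr.
Qed.

End nonnegative_weights.
End flag_sums.

(** * Energies of relations and the critical growth of flag sums *)

Section energies.
Import fintype finset bigop.
Variables (R : realType) (N : nat) (c : 'I_N -> 'I_N -> R).
Implicit Types (E : {set 'I_N * 'I_N}) (B : {set 'I_N}).

(* The exponent of the scale in the contribution to the partition function of
   the configurations whose E-classes are clusters at that scale. *)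
Definition energy (b : R) E : R :=
  2 * (rank_equiv E)%:R +
  \sum_(i < N) \sum_(j < N | (i < j)%N && ((i, j) \in E)) 2 * c i j * b.

Lemma energyE b E : is_equiv E ->
  energy b E = \sum_(B in blocks E)
    2 * (#|B|%:R - 1) * (1 + b * interaction_ratio c B).
Proof.
move=> eE; rewrite /energy rank_equivE// natr_sum mulr_sumr.
rewrite (big_blocks eE (fun i => \sum_(j < N | _ && ((i, j) \in E)) _)) -big_split /=.
apply: eq_bigr => B BE.
have B0 := card_block_gt0 eE BE.
rewrite -subn1 natrB// [RHS]mulrDr mulr1; congr (_ + _).
rewrite /interaction_ratio.
transitivity (2 * b * \sum_(i in B) \sum_(j in B | (i < j)%N) c i j).
  rewrite mulr_sumr; apply: eq_bigr => i iB; rewrite mulr_sumr.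
  apply: eq_big => [j|j _]; first by rewrite (blocks_relE eE _ BE iB) andbC.
  ring.
have [B1|B1] := eqVneq #|B| 1%N; last first.
  have : #|B|%:R - 1 != 0 :> R.
    by rewrite subr_eq0 (_ : 1 = 1%:R)// eqr_nat.
  by move=> h; field.
(* For a singleton class the ratio has denominator 0 and its value is 0; the sum over pairs is
   empty, so both sides vanish. *)
rewrite B1 subrr invr0 !(mulr0, mul0r).
have /cards1P[x ->] : #|B| == 1%N by rewrite B1.
rewrite big_set1 big1 ?mulr0// => j /andP[].
by rewrite inE => /eqP ->; rewrite ltnn.
Qed.

Lemma energy_diag b : energy b (diag_rel N) = 0.
Proof.
rewrite energyE ?is_equiv_diag// big1// => B /mem_blocks[i ->].
rewrite (_ : rel_class _ _ = [set i]%SET) ?cards1 ?subrr ?mulr0 ?mul0r//.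
by apply/setP => j; rewrite !inE /= eq_sym.
Qed.

Lemma min_ratio_le B : (2 <= #|B|)%N -> min_ratio c <= interaction_ratio c B.
Proof. exact: bigmin_le_cond. Qed.

(** The relations whose energy vanishes at the critical temperature; the diagonal is one of them,
    vacuously. *)
Definition critical_equiv E : bool :=
  [forall B in blocks E, (2 <= #|B|)%N ==> (B \in G_plus c)].

Variable b0 : R.
Hypothesis b0_gt0 : 0 < b0.
Hypothesis T_gt0 : 0 < T_plus c.

Section fixed_beta.
Variable b : R.
Hypothesis b0b : b0 <= b.
Hypothesis bT : b * T_plus c < 1.

Let eps := 1 - b * T_plus c.

Let b_gt0 : 0 < b. Proof. exact: lt_le_trans b0b. Qed.

Lemma energy_term_ge B : (0 < #|B|)%N ->
  2 * (#|B|%:R - 1) * eps <=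
  2 * (#|B|%:R - 1) * (1 + b * interaction_ratio c B).
Proof.
move=> B0; have [B1|B2] := ltnP 1 #|B|; last first.
  have -> : #|B| = 1%N by apply/eqP; rewrite eqn_leq B2.
  by rewrite subrr mulr0 !mul0r.
have h : 0 <= #|B|%:R - 1 :> R by rewrite subr_ge0 (ler_nat R 1) ltnW.
rewrite ler_wpM2l ?mulr_ge0// /eps -mulrN lerD2l ler_wpM2l ?(ltW b_gt0)//.
by rewrite opprK; exact: min_ratio_le.
Qed.

Lemma energy_ge E : is_equiv E -> 2 * (rank_equiv E)%:R * eps <= energy b E.
Proof.
move=> eE; rewrite energyE// rank_equivE// natr_sum mulr_sumr mulr_suml.
apply: ler_sum => B BE; have B0 := card_block_gt0 eE BE.
by rewrite -subn1 natrB//; exact: energy_term_ge.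
Qed.

Lemma energy_critical E : is_equiv E -> critical_equiv E ->
  energy b E = 2 * (rank_equiv E)%:R * eps.
Proof.
move=> eE /forall_inP cE; rewrite energyE// rank_equivE// natr_sum mulr_sumr.
rewrite mulr_suml; apply: eq_bigr => B BE; have B0 := card_block_gt0 eE BE.
rewrite -subn1 natrB//; have [B2|B1] := leqP 2 #|B|; last first.
  have -> : #|B| = 1%N by apply/eqP; rewrite eqn_leq -ltnS B1.
  by rewrite subrr mulr0 !mul0r.
have := implyP (cE _ BE) B2; rewrite inE => /andP[_ /eqP ->].
by rewrite /eps /T_plus mulrN opprK.
Qed.

Lemma rank_equiv_gt0 E : is_equiv E -> E != diag_rel N -> (0 < rank_equiv E)%N.
Proof.
move=> eE nE; have [B BE B2] := nontrivial_block eE nE.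
by rewrite rank_equivE// (bigD1 B)//= -subn1 addn_gt0 subn_gt0 B2.
Qed.

Lemma energy_gt0 E : is_equiv E -> E != diag_rel N -> 0 < energy b E.
Proof.
move=> eE nE; apply: lt_le_trans (energy_ge eE).
by rewrite !mulr_gt0// ?ltr0n ?rank_equiv_gt0// subr_gt0.
Qed.

Lemma energy_block_ge E B : is_equiv E -> B \in blocks E ->
  2 * (#|B|%:R - 1) * (1 + b * interaction_ratio c B) <= energy b E.
Proof.
move=> eE BE; rewrite energyE// (bigD1 B)//= ler_wpDr//.
apply: sumr_ge0 => B' /andP[B'E _]; have B'0 := card_block_gt0 eE B'E.
apply: le_trans (energy_term_ge B'0); rewrite !mulr_ge0// ?subr_ge0 ?(ltW bT)//.
by rewrite (ler_nat R 1).
Qed.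

End fixed_beta.

(** Some nontrivial class [B] has a ratio above the minimum, and 1 + b ratio = (1 - b T) + b (ratio
    - min) is at least b0 (ratio - min). The bound is uniform in b. *)
Lemma energy_noncritical E : is_equiv E -> ~~ critical_equiv E ->
  exists2 d, 0 < d & forall b, b0 <= b -> b * T_plus c < 1 -> d <= energy b E.
Proof.
move=> eE /forall_inPn[B BE]; rewrite negb_imply => /andP[B2].
rewrite inE B2 /= => nmin.
have r_gt : 0 < interaction_ratio c B - min_ratio c.
  by rewrite subr_gt0 lt_neqAle eq_sym nmin min_ratio_le.
exists (2 * (#|B|%:R - 1) * (b0 * (interaction_ratio c B - min_ratio c))).
  by rewrite !mulr_gt0// subr_gt0 (ltr_nat R 1).
move=> b b0b bT; apply: le_trans (energy_block_ge b0b bT eE BE).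
rewrite ler_wpM2l//; first by rewrite mulr_ge0// subr_ge0 (ler_nat R 1) ltnW.
move: bT; rewrite /T_plus; move: r_gt; nra.
Qed.

Variable lam : R.
Hypothesis lam_gt0 : 0 < lam.

Definition weight (b : R) E : R := expR (- (lam * energy b E)).

Lemma weight_ge0 b E : 0 <= weight b E. Proof. exact: expR_ge0. Qed.

Lemma weight_diag b : weight b (diag_rel N) = 1.
Proof. by rewrite /weight energy_diag mulr0 oppr0 expR0. Qed.

Section fixed_beta_weight.
Variable b : R.
Hypothesis b0b : b0 <= b.
Hypothesis bT : b * T_plus c < 1.

Lemma weight_lt1 E : is_equiv E -> E != diag_rel N -> weight b E < 1.
Proof.
move=> eE nE; rewrite /weight -expR0 ltr_expR oppr_lt0 mulr_gt0//.
exact: energy_gt0.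
Qed.

Lemma weight_le1 E : is_equiv E -> weight b E <= 1.
Proof.
have [->|nE eE] := eqVneq E (diag_rel N); first by rewrite weight_diag.
exact/ltW/weight_lt1.
Qed.

(** With x = lam energy, this is 1/(1 - e^-x) <= 1 + 1/x, which follows from e^-x (1 + x) <= 1. *)
Lemma inv_gap_le E : is_equiv E -> E != diag_rel N ->
  (1 - weight b E)^-1 <= 1 + (lam * energy b E)^-1.
Proof.
move=> eE nE; have x0 : 0 < lam * energy b E by rewrite mulr_gt0// energy_gt0.
have w1 := weight_lt1 eE nE.
move: x0 w1; rewrite /weight; set x := lam * _ => x0 w1.
rewrite -[leLHS]mul1r ler_pdivrMr ?subr_gt0//.
have h : 1 + x <= expR x := expR_ge1Dx x.
have h2 : expR (- x) * (1 + x) <= 1.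
  by rewrite (le_trans (ler_wpM2l (expR_ge0 _) h))// -expRD addNr expR0.
rewrite -(ler_pM2l x0); move: h2; set y := expR _ => h2.
have -> : x * ((1 + x^-1) * (1 - y)) = (x + 1) * (1 - y).
  by field; rewrite gt_eqF.
by lra.
Qed.

End fixed_beta_weight.

(** The boolean [critical_equiv E] serves as the exponent 0 or 1. A critical relation has energy at
    least 2 eps because its rank is positive; a noncritical one has energy bounded away from 0. *)
Lemma inv_gap_bound E : is_equiv E -> E != diag_rel N ->
  exists2 C, 0 < C & forall b, b0 <= b -> b * T_plus c < 1 ->
    (1 - weight b E)^-1 <= C * (1 - b * T_plus c) ^- critical_equiv E.
Proof.
move=> eE nE; have [cE|/(energy_noncritical eE)[d d0 dE]] := boolP (critical_equiv E).
  exists (1 + (2 * lam)^-1); first by rewrite addr_gt0 ?invr_gt0 ?mulr_gt0.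
  move=> b b0b bT; rewrite (le_trans (inv_gap_le b0b bT eE nE))// expr1.
  have e0 : 0 < 1 - b * T_plus c by rewrite subr_gt0.
  have e1 : 1 - b * T_plus c <= 1.
    by rewrite gerBl mulr_ge0 ?(ltW T_gt0)// (le_trans (ltW b0_gt0)).
  rewrite ler_pdivlMr// mulrDl; apply: lerD; first by rewrite mul1r.
  rewrite mulrC ler_pdivrMr ?mulr_gt0 ?energy_gt0//.
  have -> : (2 * lam)^-1 * (lam * energy b E) = energy b E / 2.
    by field; rewrite gt_eqF.
  rewrite ler_pdivlMr// mulrC (le_trans _ (energy_ge b0b eE))//.
  rewrite -mulrA ler_pM2l// ler_peMl// ?(ltW e0)//.
  by rewrite (ler_nat R 1) rank_equiv_gt0.
exists (1 + (lam * d)^-1); first by rewrite addr_gt0 ?invr_gt0 ?mulr_gt0.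
move=> b b0b bT; rewrite expr0 invr1 mulr1 (le_trans (inv_gap_le b0b bT eE nE))//.
rewrite lerD2l lef_pV2 ?posrE ?mulr_gt0//; last exact: energy_gt0.
by rewrite ler_wpM2l ?(ltW lam_gt0)// dE.
Qed.

Section eps_powers.
Variable b : R.
Hypothesis b0b : b0 <= b.
Hypothesis bT : b * T_plus c < 1.
Let eps := 1 - b * T_plus c.

Lemma eps_gt0 : 0 < 1 - b * T_plus c. Proof. by rewrite subr_gt0. Qed.

Lemma eps_le1 : 1 - b * T_plus c <= 1.
Proof. by rewrite gerBl mulr_ge0 ?(ltW T_gt0)// (le_trans (ltW b0_gt0)). Qed.

Lemma eps_expV_mono m n : (m <= n)%N -> eps ^- m <= eps ^- n.
Proof.
move=> mn; rewrite lef_pV2 ?posrE ?exprn_gt0 ?eps_gt0//.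
by rewrite ler_wiXn2l ?eps_le1 ?(ltW eps_gt0).
Qed.

Lemma eps_expV_ge1 n : 1 <= eps ^- n.
Proof. by have := eps_expV_mono (leq0n n); rewrite expr0 invr1. Qed.

End eps_powers.

(** Induction on the cardinality of [E]. The affine recursion in the length gives the bound 1 + S/(1
    - w E), where S bounds the sum over proper subrelations. If [E] is critical, the extra 1/eps is
    paid for by the strict growth of the nest depth; the constant depends neither on b nor on the
    length. *)
Lemma flag_sum_upper E : is_equiv E ->
  exists2 C, 0 < C & forall b M, b0 <= b -> b * T_plus c < 1 ->
    flag_sum (weight b) M E <=
    C * (1 - b * T_plus c) ^- nest_depth (G_plus c) E.
Proof.
have [n] := ubnP #|E|; elim: n E => [//|n IH] E; rewrite ltnS => En eE.
have [->|nE] := eqVneq E (diag_rel N).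
  exists 1 => // b M b0b bT; rewrite flag_sum_diag ?mul1r ?weight_diag//.
  exact: eps_expV_ge1.
have [C1 C1_gt0 gap] := inv_gap_bound eE nE.
(* A constant for every relation, 1 where the induction hypothesis does not apply, so that they can
   be chosen simultaneously. *)
have : forall E' : {set 'I_N * 'I_N}, exists C : R, 0 < C /\
    (is_equiv E' && (E' \proper E) -> forall b M, b0 <= b -> b * T_plus c < 1 ->
    flag_sum (weight b) M E' <=
    C * (1 - b * T_plus c) ^- nest_depth (G_plus c) E').
  move=> E'; have [/andP[eE' pE']|] := boolP (is_equiv E' && (E' \proper E)).
    have [|C C_gt0 h] := IH E' _ eE'; last by exists C.
    exact: leq_trans (proper_card pE') En.
  by exists 1.
move/fin_all_exists => [C_ hC].
exists (1 + C1 * \sum_E' C_ E').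
  rewrite addr_gt0// mulr_gt0// (bigD1 E)//= ltr_pwDl ?(hC E).1//.
  by apply: sumr_ge0 => E' _; rewrite ltW// (hC E').1.
move=> b M b0b bT; have e0 := eps_gt0 bT.
pose eps := 1 - b * T_plus c.
have w1 := weight_lt1 b0b bT eE nE.
pose P E' := is_equiv E' && (E' \proper E).
pose S := \sum_(E' | P E') C_ E' * eps ^- nest_depth (G_plus c) E'.
have S_ge0 : 0 <= S.
  by apply: sumr_ge0 => E' _; rewrite mulr_ge0 ?invr_ge0 ?exprn_ge0 ?ltW ?(hC E').1.
have FM k : flag_sum (weight b) k E <= 1 + (1 - weight b E)^-1 * S.
  elim: k => [|k IHk] /=.
    by rewrite lerDl mulr_ge0// invr_ge0 subr_ge0 ltW.
  rewrite -/(flag_sum (weight b) k.+1 E) flag_sumS//.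
  have hS : \sum_(E' | P E') weight b E' * flag_sum (weight b) k E' <= S.
    apply: ler_sum => E' PE'; have [eE' _] := andP PE'.
    apply: le_trans ((hC E').2 PE' b k b0b bT).
    rewrite ler_piMl ?weight_le1//.
    by apply: flag_sum_ge0; exact: weight_ge0.
  apply: le_trans (lerD (ler_wpM2l (weight_ge0 b E) IHk) hS) _.
  move: w1 S_ge0; set w := weight b E; set t := (1 - w)^-1 => w1 S_ge0.
  (* Since t S is the fixed point of y -> w y + S, one step of the recursion keeps the bound 1 + t
     S. *)
  have tE : t * (1 - w) = 1 by rewrite mulVf// gt_eqF// subr_gt0.
  have -> : w * (1 + t * S) + S = w + t * S - (t * (1 - w) - 1) * S by ring.
  by rewrite tE subrr mul0r subr0 lerD2r ltW.
rewrite (le_trans (FM M))// mulrDl mul1r; apply: lerD.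
  exact: eps_expV_ge1.
rewrite (le_trans (ler_wpM2r S_ge0 (gap b b0b bT)))//.
rewrite -!mulrA ler_pM2l// /S mulr_sumr mulr_suml [leRHS](bigID P) /=.
rewrite ler_wpDr//.
  apply: sumr_ge0 => E' _; rewrite mulr_ge0 ?invr_ge0 ?exprn_ge0 ?(ltW e0)//.
  by rewrite ltW// (hC E').1.
apply: ler_sum => E' /andP[eE' pE'].
rewrite mulrCA ler_pM2l ?(hC E').1// -invfM -exprD.
apply: eps_expV_mono => //; case: (boolP (critical_equiv E)) => cE.
  rewrite add1n; apply: nest_depth_lt => // B BE B2.
  exact: (implyP (forall_inP cE _ BE)).
by rewrite add0n; apply: nest_depth_mono; exact: proper_sub.
Qed.

Lemma weight_ge b E : b0 <= b -> b * T_plus c < 1 -> is_equiv E ->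
  critical_equiv E -> expR (- (lam * (2 * N%:R))) <= weight b E.
Proof.
move=> b0b bT eE cE; rewrite /weight ler_expR lerN2 ler_pM2l//.
rewrite energy_critical// -mulrA ler_pM2l//.
rewrite -[leRHS]mulr1 ler_pM ?(ltW (eps_gt0 bT)) ?eps_le1//.
by rewrite ler_nat rank_equiv_le.
Qed.

Lemma nest_critical (K : {set {set 'I_N}}) : K \subset G_plus c -> nest K ->
  critical_equiv (nest_rel K).
Proof.
move=> /subsetP KG nK; apply/forall_inP => B BE; apply/implyP => B2.
exact/KG/(nest_rel_block nK BE).
Qed.

(** Induction on the nest, removing a largest member [S]. Flags that repeat [E] and then pass to the
    relation [E'] of the remaining nest form a geometric series of sum 1/(1 - w E), of order 1/eps.
    The length depends on b, since the series has to be cut far enough. *)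
Lemma flag_sum_lower (K : {set {set 'I_N}}) : K \subset G_plus c -> nest K ->
  exists2 C, 0 < C & forall b, b0 <= b -> b * T_plus c < 1 ->
    exists M, C * (1 - b * T_plus c) ^- #|K| <=
              flag_sum (weight b) M (nest_rel K).
Proof.
have [n] := ubnP #|K|; elim: n K => [//|n IH] K; rewrite ltnS => Kn KG nK.
have [->|/finset.set0Pn[S0 S0K]] := eqVneq K finset.set0.
  exists 1 => // b b0b bT; exists 0%N.
  by rewrite cards0 expr0 invr1 mulr1.
pose S := [arg max_(S > S0 in K) #|S|].
have [SK Smax] : S \in K /\ forall S', S' \in K -> (#|S'| <= #|S|)%N.
  by rewrite /S; case: arg_maxnP.
have S2 : (2 <= #|S|)%N.
  by have := subsetP KG _ SK; rewrite inE => /andP[].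
have K'G : (K :\ S)%SET \subset G_plus c by apply: subset_trans KG; exact: subsetDl.
have nK' := nestD1 S nK.
have pK := nest_rel_proper nK SK S2 Smax.
have cK : #|K| = #|(K :\ S)%SET|.+1 by rewrite (cardsD1 S K) SK.
have [|C C_gt0 hC] := IH _ _ K'G nK'; first by rewrite -cK.
set E := nest_rel K in pK *; set E' := nest_rel (K :\ S)%SET in hC pK.
have eE : is_equiv E := nest_rel_equiv nK.
have eE' : is_equiv E' := nest_rel_equiv nK'.
have nE : E != diag_rel N.
  apply: contraL pK => /eqP ->; rewrite fintype.properE negb_and.
  by rewrite diag_sub_equiv ?orbT.
have N0 : 0 < N%:R :> R.
  rewrite ltr0n; apply: leq_trans (rank_equiv_le E).
  exact: rank_equiv_gt0.
pose D := lam * (2 * N%:R).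
exists (C * expR (- D) / (2 * D)).
  by rewrite !mulr_gt0 ?invr_gt0 ?expR_gt0 ?mulr_gt0.
move=> b b0b bT; have [M0 hM0] := hC b b0b bT.
have e0 := eps_gt0 bT.
set eps := 1 - b * T_plus c in hM0 e0 *.
have w1 := weight_lt1 b0b bT eE nE.
have cE' := nest_critical K'G nK'.
have cE := nest_critical KG nK.
(* The full sum of the geometric series; [FM] bounds its first m terms, keeping only [E'] among the
   proper subrelations. *)
pose G := (1 - weight b E)^-1 * (expR (- D) * (C * eps ^- #|(K :\ S)%SET|)).
have G_ge0 : 0 <= G.
  by rewrite !mulr_ge0 ?invr_ge0 ?subr_ge0 ?(ltW w1) ?expR_ge0 ?(ltW C_gt0) ?exprn_ge0 ?ltW.
have FM m : (1 - weight b E ^+ m) * G <= flag_sum (weight b) (M0 + m) E.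
  elim: m => [|m IHm].
    by rewrite expr0 subrr mul0r; apply: flag_sum_ge0; exact: weight_ge0.
  rewrite addnS flag_sumS//.
  have h1 : weight b E * ((1 - weight b E ^+ m) * G) <=
            weight b E * flag_sum (weight b) (M0 + m) E.
    by rewrite ler_wpM2l// weight_ge0.
  have h2 : (1 - weight b E) * G <= \sum_(F | is_equiv F && (F \proper E))
       weight b F * flag_sum (weight b) (M0 + m) F.
    rewrite (bigD1 E') /=; last by rewrite eE' pK.
    rewrite ler_wpDr//.
      apply: sumr_ge0 => F _; rewrite mulr_ge0 ?weight_ge0//.
      by apply: flag_sum_ge0; exact: weight_ge0.
    rewrite /G mulVKf ?gt_eqF ?subr_gt0//.
    apply: ler_pM; rewrite ?expR_ge0 ?mulr_ge0 ?invr_ge0 ?exprn_ge0 ?(ltW C_gt0) ?(ltW e0)//.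
      exact: weight_ge.
    apply: le_trans hM0 _; apply: flag_sum_leq => //.
    - exact: weight_ge0.
    - exact: weight_diag.
    - exact: leq_addr.
  apply: le_trans (lerD h1 h2); rewrite exprS le_eqVlt; apply/orP; left.
  by apply/eqP; ring.
have a0 : 0 < lam * energy b E by rewrite mulr_gt0// energy_gt0.
(* With x = lam energy and m >= 1/x, e^(-m x) <= 1/(1 + m x) <= 1/2, so m terms make up half of the
   series. *)
have [m hm] : exists m, weight b E ^+ m <= 2^-1.
  exists (archimedean.Num.bound (lam * energy b E)^-1).
  have /ltW : (lam * energy b E)^-1 < (archimedean.Num.bound (lam * energy b E)^-1)%:R.
    by apply: archimedean.Num.Theory.archi_boundP; rewrite invr_ge0 ltW.
  set m := archimedean.Num.bound _ => hm.
  rewrite /weight -expRM_natr mulNr expRN lef_pV2 ?posrE ?expR_gt0//.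
  apply: le_trans (expR_ge1Dx _); rewrite -[2]/(1 + 1) lerD2l.
  by rewrite mulrC -ler_pdivrMr// mul1r.
exists (M0 + m)%N; apply: le_trans (FM m).
apply: (@le_trans _ _ (2^-1 * G)); last first.
  rewrite ler_wpM2r// lerBrDr -lerBrDl (le_trans hm)//.
  by rewrite lerBrDr -[X in X + X]mul1r -mulrDl divff.
rewrite cK exprS /G.
have -> : C * expR (- D) / (2 * D) / (eps * eps ^+ #|(K :\ S)%SET|) =
  2^-1 * ((D * eps)^-1 * (expR (- D) * (C * eps ^- #|(K :\ S)%SET|))).
  by rewrite !invfM; ring.
rewrite ler_pM2l ?invr_gt0// ler_wpM2r//.
  by rewrite !mulr_ge0 ?invr_ge0 ?expR_ge0 ?(ltW C_gt0) ?exprn_ge0 ?ltW.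
(* 1 - e^-x <= x, and for a critical relation x = 2 lam rank eps <= D eps. *)
rewrite lef_pV2 ?posrE ?subr_gt0 ?mulr_gt0//.
rewrite (@le_trans _ _ (lam * energy b E))//.
  by rewrite lerBlDr addrC -lerBlDr; exact: expR_ge1Dx.
rewrite /D -mulrA ler_pM2l// energy_critical// ler_pM2r// ler_pM2l//.
by rewrite ler_nat rank_equiv_le.
Qed.

End energies.

(** * The chordal distance and its rotations *)

Section chordal_distance.
Context {R : realType}.
Implicit Types p q x y : 3.-tuple R.

Local Notation i0 := (@Ordinal 3 0 isT).
Local Notation i1 := (@Ordinal 3 1 isT).
Local Notation i2 := (@Ordinal 3 2 isT).

Lemma sum3E (F : 'I_3 -> R) : \sum_(k < 3) F k = F i0 + F i1 + F i2.
Proof.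
rewrite !big_ord_recl big_ord0 addr0 addrA.
by congr (F _ + F _ + F _); exact: val_inj.
Qed.

Lemma ord3P (i : 'I_3) : [\/ i = i0, i = i1 | i = i2].
Proof.
case: i => -[|[|[|//]]] h; [apply: Or31|apply: Or32|apply: Or33]; exact: val_inj.
Qed.

Lemma chordal_ge0 p q : 0 <= chordal_dist p q.
Proof. exact: sqrtr_ge0. Qed.

Lemma chordal_sqr p q :
  chordal_dist p q ^+ 2 = \sum_(k < 3) (tnth p k - tnth q k) ^+ 2.
Proof. by rewrite sqr_sqrtr// sumr_ge0// => k _; rewrite sqr_ge0. Qed.

Lemma chordalC p q : chordal_dist p q = chordal_dist q p.
Proof. by congr Num.sqrt; apply: eq_bigr => k _; rewrite -sqrrN opprB. Qed.

Lemma chordalxx p : chordal_dist p p = 0.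
Proof. by rewrite /chordal_dist big1 ?sqrtr0// => k _; rewrite subrr expr0n. Qed.

Lemma chordal_le p q (r : R) : 0 <= r ->
  (chordal_dist p q <= r) = (\sum_(k < 3) (tnth p k - tnth q k) ^+ 2 <= r ^+ 2).
Proof. by move=> r0; rewrite -chordal_sqr ler_sqr ?nnegrE// chordal_ge0. Qed.

Lemma coord_le_chordal p q k : `|tnth p k - tnth q k| <= chordal_dist p q.
Proof.
rewrite -ler_sqr ?nnegrE// ?chordal_ge0// chordal_sqr (bigD1 k)//= real_normK ?num_real//.
by rewrite lerDl sumr_ge0// => i _; rewrite sqr_ge0.
Qed.

Lemma chordal_triangle q p x :
  chordal_dist p x <= chordal_dist p q + chordal_dist q x.
Proof.
(* Minkowski's inequality in coordinates; Cauchy-Schwarz comes from Lagrange's identity. *)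
have cs (a0 a1 a2 b0 b1 b2 A B : R) : 0 <= A -> 0 <= B ->
    A ^+ 2 = a0 ^+ 2 + a1 ^+ 2 + a2 ^+ 2 ->
    B ^+ 2 = b0 ^+ 2 + b1 ^+ 2 + b2 ^+ 2 ->
    (a0 + b0) ^+ 2 + (a1 + b1) ^+ 2 + (a2 + b2) ^+ 2 <= (A + B) ^+ 2.
  move=> A0 B0 hA hB.
  have h : a0 * b0 + a1 * b1 + a2 * b2 <= A * B.
    apply: le_trans (ler_norm _) _.
    rewrite -ler_sqr ?nnegrE ?mulr_ge0// exprMn hA hB real_normK ?num_real//.
    have -> : (a0 ^+ 2 + a1 ^+ 2 + a2 ^+ 2) * (b0 ^+ 2 + b1 ^+ 2 + b2 ^+ 2) =
      (a0 * b0 + a1 * b1 + a2 * b2) ^+ 2 +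
      ((a0 * b1 - a1 * b0) ^+ 2 + (a0 * b2 - a2 * b0) ^+ 2
      + (a1 * b2 - a2 * b1) ^+ 2) by ring.
    by rewrite lerDl !addr_ge0// sqr_ge0.
  have -> : (A + B) ^+ 2 = A ^+ 2 + B ^+ 2 + 2 * (A * B) by ring.
  by rewrite hA hB; lra.
rewrite chordal_le ?addr_ge0 ?chordal_ge0// sum3E.
have E k : tnth p k - tnth x k = (tnth p k - tnth q k) + (tnth q k - tnth x k) by ring.
by rewrite !E cs ?chordal_ge0// chordal_sqr sum3E.
Qed.

Lemma chordal_sphere_le2 p q : unit_sphere p -> unit_sphere q ->
  chordal_dist p q <= 2.
Proof.
rewrite /unit_sphere /= => hp hq; pose o : 3.-tuple R := [tuple 0 | k < 3].
have ho x : \sum_(k < 3) tnth x k ^+ 2 = 1 -> chordal_dist x o = 1.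
  move=> h; rewrite /chordal_dist -[RHS]sqrtr1 -h; congr Num.sqrt.
  by apply: eq_bigr => k _; rewrite tnth_mktuple subr0.
by have := chordal_triangle o p q; rewrite [X in _ + X]chordalC !ho.
Qed.

Lemma measurable_chordal d (T : measurableType d) (f g : T -> 3.-tuple R) :
  measurable_fun setT f -> measurable_fun setT g ->
  measurable_fun setT (fun t => chordal_dist (f t) (g t)).
Proof.
move=> mf mg; rewrite /chordal_dist.
rewrite (_ : (fun t => _) =
    (@powR R ^~ 2^-1) \o (fun t => \sum_(k < 3) (tnth (f t) k - tnth (g t) k) ^+ 2)).
  apply: measurableT_comp; first exact: measurable_powR.
  apply: measurable_sum => k; apply: measurable_funX; apply: measurable_funB.
    apply: (@measurableT_comp _ _ _ _ _ _ (fun x => tnth x k)) => //.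
    exact: measurable_tnth.
  apply: (@measurableT_comp _ _ _ _ _ _ (fun x => tnth x k)) => //.
  exact: measurable_tnth.
apply/funext => t /=; rewrite powR12_sqrt// sumr_ge0// => k _.
exact: sqr_ge0.
Qed.

Lemma measurable_unit_sphere : measurable (@unit_sphere R).
Proof.
have mf : measurable_fun setT
    (fun p : 3.-tuple R => \sum_(k < 3) tnth p k ^+ 2).
  by apply: measurable_sum => k; apply: measurable_funX; exact: measurable_tnth.
rewrite (_ : unit_sphere = setT `&`
   (fun p : 3.-tuple R => \sum_(k < 3) tnth p k ^+ 2) @^-1` [set 1]).
  by apply: mf.
by rewrite setTI.
Qed.

Definition chordal_ball p (r : R) : set (3.-tuple R) :=
  [set x | chordal_dist x p <= r].

Lemma measurable_chordal_ball p r : measurable (chordal_ball p r).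
Proof.
have mf : measurable_fun setT (fun x => chordal_dist x p).
  by apply: measurable_chordal => //; exact: measurable_cst.
rewrite (_ : chordal_ball p r = setT `&` (fun x => chordal_dist x p) @^-1` `]-oo, r]%classic).
  by apply: mf.
by rewrite setTI; apply/seteqP; split=> x /=; rewrite in_itv.
Qed.

Lemma rotate_isometry (Q : 'M[R]_3) x y : rotation Q ->
  chordal_dist (rotate Q x) (rotate Q y) = chordal_dist x y.
Proof.
move=> [/mulmx1C QQ _]; congr Num.sqrt.
pose z : 'cV[R]_3 := \col_k (tnth x k - tnth y k).
have normE (u : 'cV[R]_3) : \sum_(k < 3) u k 0 ^+ 2 = (u^T *m u) 0 0.
  by rewrite mxE; apply: eq_bigr => k _; rewrite mxE expr2.
transitivity (\sum_(k < 3) (Q *m z) k 0 ^+ 2).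
  apply: eq_bigr => k _; rewrite !tnth_mktuple mxE -sumrB; congr (_ ^+ 2).
  by apply: eq_bigr => i _; rewrite mxE mulrBr.
rewrite normE trmx_mul mulmxA -[z^T *m _ *m _]mulmxA QQ mulmx1 -normE.
by apply: eq_bigr => k _; rewrite mxE.
Qed.

Lemma det3E (M : 'M[R]_3) : \det M =
  M i0 i0 * (M i1 i1 * M i2 i2 - M i1 i2 * M i2 i1)
  - M i0 i1 * (M i1 i0 * M i2 i2 - M i1 i2 * M i2 i0)
  + M i0 i2 * (M i1 i0 * M i2 i1 - M i1 i1 * M i2 i0).
Proof.
have E2 (A : 'M[R]_2) : \det A = A 0 0 * A 1 1 - A 0 1 * A 1 0.
  rewrite (expand_det_row _ ord0) !big_ord_recl big_ord0 addr0 /cofactor.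
  rewrite !det_mx11 !mxE /= !addn0 expr0 expr1 mul1r mulN1r mulrN.
  by congr (A _ _ * A _ _ - A _ _ * A _ _); exact: val_inj.
rewrite (expand_det_row _ ord0) sum3E /cofactor !E2 !mxE /= !add0n.
rewrite expr0 expr1 mul1r mulN1r mulrN sqrrN expr1n mul1r.
by congr (M _ _ * (M _ _ * M _ _ - M _ _ * M _ _) - M _ _ * (M _ _ * M _ _ - M _ _ * M _ _) + M _ _ * (M _ _ * M _ _ - M _ _ * M _ _)); exact: val_inj.
Qed.

(* The half-turn about the axis p + q exchanges p and q. *)
Definition half_turn p q : 'M[R]_3 :=
  \matrix_(i, j) (2 * (tnth p i + tnth q i) * (tnth p j + tnth q j) /
     (\sum_(k < 3) (tnth p k + tnth q k) ^+ 2) - (i == j)%:R).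

Section half_turns.
Variables p q : 3.-tuple R.
Hypothesis s_neq0 : \sum_(k < 3) (tnth p k + tnth q k) ^+ 2 != 0.

Lemma half_turn_rotation : rotation (half_turn p q).
Proof.
move: s_neq0; rewrite sum3E => s0; split.
  apply/matrixP => i j; rewrite !mxE sum3E !mxE sum3E.
  move: s0; have := ord3P j; have := ord3P i.
  move: (tnth p) (tnth q) => P Q hi hj.
  by case: hi => ->; case: hj => -> ;
   move: (P i0 + Q i0) (P i1 + Q i1) (P i2 + Q i2) => v0 v1 v2 s0 /=; field.
rewrite det3E !mxE sum3E /=; move: s0.
move: (tnth p i0 + _) (tnth p i1 + _) (tnth p i2 + _) => v0 v1 v2 s0.
by field.
Qed.

Lemma half_turnE : unit_sphere p -> unit_sphere q ->
  rotate (half_turn p q) p = q.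
Proof.
rewrite /unit_sphere /= => hp hq; apply: eq_from_tnth => i.
rewrite tnth_mktuple sum3E !mxE; move: hp hq s_neq0; rewrite !sum3E.
have := ord3P i; move: (tnth p) (tnth q) => P Q hi hp hq.
set s := (X in X != 0) => s0.
(* As |p| = |q|, |p + q|^2 = 2 p.(p + q), so the half-turn sends p to (p + q) - p. *)
have sE : s = 2 * (P i0 * (P i0 + Q i0) + P i1 * (P i1 + Q i1) + P i2 * (P i2 + Q i2)).
  apply/eqP; rewrite -subr_eq0 /s.
  have -> : forall a0 a1 a2 b0 b1 b2 : R, (a0 + b0) ^+ 2 + (a1 + b1) ^+ 2 + (a2 + b2) ^+ 2 -
     2 * (a0 * (a0 + b0) + a1 * (a1 + b1) + a2 * (a2 + b2)) =
     (b0 ^+ 2 + b1 ^+ 2 + b2 ^+ 2) - (a0 ^+ 2 + a1 ^+ 2 + a2 ^+ 2) by move=> *; ring.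
  by rewrite hp hq subrr.
transitivity (s / s * (P i + Q i) - P i); last first.
  by rewrite divff// mul1r addrC addKr.
rewrite [X in X / s * _]sE -/s; move: s s0 {sE hp hq} => s s0.
by case: hi => -> /=; field.
Qed.

End half_turns.

Lemma nonantipodal_exists p q : unit_sphere p -> unit_sphere q ->
  exists z : 3.-tuple R, [/\ unit_sphere z,
    \sum_(k < 3) (tnth p k + tnth z k) ^+ 2 != 0 &
    \sum_(k < 3) (tnth z k + tnth q k) ^+ 2 != 0].
Proof.
move=> hp hq; pose e j : 3.-tuple R := [tuple (k == j)%:R | k < 3].
have eE x j : unit_sphere x ->
    \sum_(k < 3) (tnth x k + tnth (e j) k) ^+ 2 = 2 * (tnth x j + 1).
  rewrite /unit_sphere /= => hx; transitivity (\sum_(k < 3) (tnth x k ^+ 2 +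
     (if k == j then 2 * tnth x k + 1 else 0))).
    apply: eq_bigr => k _; rewrite tnth_mktuple; case: (k == j) => /=; ring.
  by rewrite big_split /= hx -big_mkcond big_pred1_eq; ring.
have one x i j : unit_sphere x -> i != j -> tnth x i = -1 -> tnth x j + 1 != 0.
  rewrite /unit_sphere /= => hx ij xi; apply/eqP => xj.
  have : tnth x i ^+ 2 + tnth x j ^+ 2 <= 1.
    rewrite -hx (bigD1 i)//= (bigD1 j)//= 1?eq_sym//.
    by rewrite addrA lerDl sumr_ge0// => k _; rewrite sqr_ge0.
  have -> : tnth x j = -1 by apply/eqP; rewrite -addr_eq0 xj.
  by rewrite xi !sqrrN expr1n; lra.
suff [j [pj qj]] : exists j, tnth p j + 1 != 0 /\ tnth q j + 1 != 0.
  exists (e j); split.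
  - rewrite /unit_sphere /= (bigD1 j)//= tnth_mktuple eqxx big1; first by rewrite expr1n addr0.
    by move=> k kj; rewrite tnth_mktuple (negbTE kj) expr0n.
  - by rewrite eE// mulf_neq0.
  - under eq_bigr do rewrite addrC.
    by rewrite eE// mulf_neq0.
have dec x i : {tnth x i = -1} + {tnth x i + 1 != 0}.
  by rewrite addr_eq0; case: eqVneq => h; [left|right].
have [p0|p0] := dec p i0.
  have [q1|q1] := dec q i1; [exists i2|exists i1]; split=> //.
  - exact: (one p i0 i2).
  - exact: (one q i1 i2).
  - exact: (one p i0 i1).
have [q0|q0] := dec q i0; last by exists i0.
have [p1|p1] := dec p i1; [exists i2|exists i1]; split=> //.
- exact: (one p i1 i2).
- exact: (one q i0 i2).
- exact: (one q i0 i1).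
Qed.

End chordal_distance.

(** * The mass of spherical balls *)

Section step_functions.
Context d (T : measurableType d) (R : realType) (P : {measure set T -> \bar R}).
Variables (D : set T) (mD : measurable D).
Variables (I : Type) (s : seq I) (A : I -> set T) (v : I -> R).
Hypothesis mA : forall i, measurable (A i).
Hypothesis v_ge0 : forall i, 0 <= v i.

Let step x : R := \sum_(i <- s) v i * \1_(A i) x.

Let mEFin (g : T -> R) : measurable_fun D g ->
  measurable_fun D (fun x => (g x)%:E).
Proof. by move=> mg; exact/measurable_EFinP. Qed.

Let measurable_step : measurable_fun D step.
Proof.
apply: measurable_sum => i; apply: measurable_funM; first exact: measurable_cst.
by apply: measurable_funTS; exact: measurable_indic.
Qed.

Let step_ge0 x : 0 <= step x.
Proof. by apply: sumr_ge0 => i _; rewrite mulr_ge0. Qed.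

Lemma integral_step :
  (\int[P]_(x in D) (step x)%:E = \sum_(i <- s) (v i)%:E * P (A i `&` D))%E.
Proof.
under eq_integral do rewrite /step -sumEFin.
rewrite ge0_integral_sum//.
- apply: eq_bigr => i _; rewrite -integral_indic//.
  under eq_integral do rewrite EFinM.
  rewrite ge0_integralZl_EFin//.
  by apply: mEFin; apply: measurable_funTS; exact: measurable_indic.
- move=> i; apply: mEFin; apply: measurable_funM.
    exact: measurable_cst.
  by apply: measurable_funTS; exact: measurable_indic.
- by move=> i x _; rewrite lee_fin mulr_ge0.
Qed.

Variable f : T -> R.
Hypothesis mf : measurable_fun D f.

Lemma sum_le_integral :
  (forall x, D x -> \sum_(i <- s) v i * \1_(A i) x <= f x) ->
  (\sum_(i <- s) (v i)%:E * P (A i `&` D) <= \int[P]_(x in D) (f x)%:E)%E.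
Proof.
move=> h; rewrite -integral_step; apply: ge0_le_integral.
- exact: mD.
- by move=> x _; rewrite lee_fin.
- exact: mEFin.
- exact: mEFin.
- by move=> x Dx; rewrite lee_fin; exact: h.
Qed.

Lemma integral_le_sum : (forall x, D x -> 0 <= f x) ->
  (forall x, D x -> f x <= \sum_(i <- s) v i * \1_(A i) x) ->
  (\int[P]_(x in D) (f x)%:E <= \sum_(i <- s) (v i)%:E * P (A i `&` D))%E.
Proof.
move=> f0 h; rewrite -integral_step; apply: ge0_le_integral.
- exact: mD.
- by move=> x Dx; rewrite lee_fin f0.
- exact: mEFin.
- exact: mEFin.
- by move=> x Dx; rewrite lee_fin; exact: h.
Qed.

End step_functions.

(** For disjoint sets at most one term is nonzero; used with [sum_le_integral] for packings. *)
Lemma sum_indic_le (T : Type) (R : realType) (I : eqType) (s : seq I)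
    (A : I -> set T) (v : I -> R) x (y : R) : uniq s -> 0 <= y ->
  (forall i j, i \in s -> j \in s -> A i x -> A j x -> i = j) ->
  (forall i, i \in s -> A i x -> v i <= y) ->
  \sum_(i <- s) v i * \1_(A i) x <= y.
Proof.
move=> us y0 disj vy.
have [[i [si Aix]]|no] := pselect (exists i, i \in s /\ A i x).
  rewrite (bigD1_seq i)//= big_seq_cond big1 ?addr0.
    by rewrite indicE mem_set// mulr1 vy.
  move=> j /andP[sj ji]; rewrite indicE memNset ?mulr0// => Ajx.
  by move/eqP: ji; apply; apply: disj.
rewrite big_seq big1// => i si; rewrite indicE memNset ?mulr0// => Aix.
by apply: no; exists i.
Qed.

(** One set containing the point suffices, overlaps being allowed; used with [integral_le_sum] for
    coverings. *)
Lemma le_sum_indic (T : Type) (R : realType) (I : eqType) (s : seq I)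
    (A : I -> set T) (v : I -> R) x (y : R) i : (forall j, 0 <= v j) ->
  i \in s -> A i x -> y <= v i -> y <= \sum_(j <- s) v j * \1_(A j) x.
Proof.
move=> v0 si Aix yv; apply: le_trans yv _; elim: s si => //= j s IH.
rewrite inE big_cons => /predU1P[<-|/IH h].
  rewrite indicE mem_set// mulr1 ler_wpDr// sumr_ge0// => k _.
  by rewrite mulr_ge0.
by rewrite ler_wpDl// mulr_ge0.
Qed.

(** * Balls of radius r have mass of order r^2 *)

Section sphere_regularity.
Context {R : realType}.
Variable mu : probability (3.-tuple R) R.
Hypothesis mu_inv : invariant_sphere_probability mu.

Local Notation i0 := (@Ordinal 3 0 isT).
Local Notation i1 := (@Ordinal 3 1 isT).
Local Notation i2 := (@Ordinal 3 2 isT).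

Lemma mu_ball_half_turn (p q : 3.-tuple R) r : unit_sphere p -> unit_sphere q ->
  \sum_(k < 3) (tnth p k + tnth q k) ^+ 2 != 0 ->
  mu (chordal_ball p r) = mu (chordal_ball q r).
Proof.
move=> hp hq s0; have rQ := half_turn_rotation s0.
rewrite -(mu_inv.2 _ rQ (chordal_ball q r)); last exact: measurable_chordal_ball.
congr (mu _); rewrite -{2}(half_turnE s0 hp hq).
by apply/seteqP; split => x /=; rewrite /chordal_ball /= rotate_isometry.
Qed.

Lemma mu_ball_eq (p q : 3.-tuple R) r : unit_sphere p -> unit_sphere q ->
  mu (chordal_ball p r) = mu (chordal_ball q r).
Proof.
move=> hp hq; have [z [hz pz zq]] := nonantipodal_exists hp hq.
by rewrite (mu_ball_half_turn _ hp hz)// (mu_ball_half_turn _ hz hq).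
Qed.

Lemma mu_ball_le1 p r : (mu (chordal_ball p r) <= 1)%E.
Proof. by apply: probability_le1; exact: measurable_chordal_ball. Qed.

Lemma mu_ball_fin p r : mu (chordal_ball p r) = (fine (mu (chordal_ball p r)))%:E.
Proof. by rewrite fineK// fin_num_measure//; exact: measurable_chordal_ball. Qed.

Lemma ball_mass_mono p r r' : r <= r' ->
  fine (mu (chordal_ball p r)) <= fine (mu (chordal_ball p r')).
Proof.
move=> rr'; rewrite -lee_fin -!mu_ball_fin le_measure ?inE//.
- exact: measurable_chordal_ball.
- exact: measurable_chordal_ball.
- by move=> x /= /le_trans; apply.
Qed.

(* Points whose first two coordinates run through a grid of mesh 1/(2m) are
   1/(2m)-separated, so that the m^2 balls around them are disjoint. *)
Lemma ball_packing p (m : nat) : unit_sphere p -> (0 < m)%N ->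
  m%:R ^+ 2 * fine (mu (chordal_ball p (6 * m%:R)^-1)) <= 1 :> R.
Proof.
move=> hp m0; have m_gt0 : 0 < m%:R :> R by rewrite ltr0n.
(* The grid stays in [0, 1/2], so that 1 minus the two squares is nonnegative and the third
   coordinate is a genuine square root. *)
pose g (i : 'I_m) : R := i%:R / (2 * m%:R).
have gb i : 0 <= g i <= 2^-1.
  rewrite /g; apply/andP; split; first by rewrite divr_ge0// mulr_ge0.
  rewrite ler_pdivrMr ?mulr_gt0// mulrA mulVf// mul1r ler_nat.
  exact/ltnW/ltn_ord.
pose h (ij : 'I_m * 'I_m) : R := 1 - (g ij.1 ^+ 2 + g ij.2 ^+ 2).
have h_ge0 ij : 0 <= h ij.
  have sq i : g i ^+ 2 <= 2^-1 ^+ 2.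
    by have /andP[x0 x1] := gb i; rewrite lerXn2r ?nnegrE// invr_ge0.
  have := lerD (sq ij.1) (sq ij.2); rewrite /h; lra.
pose f (ij : 'I_m * 'I_m) : 3.-tuple R :=
  [tuple [:: g ij.1; g ij.2; Num.sqrt (h ij)]`_k | k < 3].
have hf ij : unit_sphere (f ij).
  rewrite /unit_sphere /= sum3E !tnth_mktuple /= sqr_sqrtr// /h.
  by rewrite addrC subrK.
(* Balls of radius 1/(6m) that meet have centers within 1/(3m), which is less than the mesh
   1/(2m). *)
have sep k ij kl : chordal_dist (f ij) (f kl) <= 2 * (6 * m%:R)^-1 ->
    `|tnth (f ij) k - tnth (f kl) k| < (2 * m%:R)^-1.
  move=> h1; apply: (le_lt_trans (coord_le_chordal _ _ _)).
  apply: le_lt_trans h1 _; rewrite !invfM.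
  have : 0 < m%:R^-1 :> R by rewrite invr_gt0.
  by move: (m%:R^-1) => t; lra.
have gsep (i j : 'I_m) : `|g i - g j| < (2 * m%:R)^-1 -> i = j.
  rewrite /g -mulrBl normrM [`|_^-1|]ger0_norm ?invr_ge0 ?mulr_ge0//.
  rewrite ltr_pdivrMr ?mulr_gt0// mulVf ?gt_eqF ?mulr_gt0// => ij.
  move/ltr_normlP: ij => [h1 h2]; apply/val_inj => /=.
  by case: (ltngtP i j) => // ij; exfalso; move: ij; rewrite -(ler_nat R) -natr1;
    move: h1 h2; lra.
have disj ij kl x : chordal_ball (f ij) (6 * m%:R)^-1 x ->
    chordal_ball (f kl) (6 * m%:R)^-1 x -> ij = kl.
  rewrite /chordal_ball /= => h1 h2.
  have h3 : chordal_dist (f ij) (f kl) <= 2 * (6 * m%:R)^-1.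
    rewrite (le_trans (chordal_triangle x _ _))// mulrDl !mul1r lerD//.
    by rewrite chordalC.
  have := sep i0 _ _ h3; have := sep i1 _ _ h3.
  rewrite !tnth_mktuple /= => /gsep h4 /gsep h5.
  by case: ij kl {h1 h2 h3} h4 h5 => ? ? [? ?] /= -> ->.
have := @sum_le_integral _ _ R mu setT measurableT _ (enum {: 'I_m * 'I_m})
  (fun ij => chordal_ball (f ij) (6 * m%:R)^-1) (fun=> 1)
  (fun ij => measurable_chordal_ball _ _) (fun=> ler01) (fun=> 1)
  (measurable_cst _).
have -> : (\int[mu]_(x in setT) (1 : R)%:E = 1)%E.
  by rewrite integral_cst// mul1e; exact: probability_setT.
move=> H.
rewrite -lee_fin; apply: le_trans (H _); last first.
  move=> x _; apply: sum_indic_le => //; first exact: enum_uniq.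
  by move=> i j _ _; apply: disj.
rewrite (eq_bigr (fun=> (fine (mu (chordal_ball p (6 * m%:R)^-1)))%:E)); last first.
  move=> ij _; rewrite mul1e setIT.
  exact: etrans (mu_ball_eq _ (hf ij) hp) (mu_ball_fin _ _).
rewrite sumEFin big_enum sumr_const /= card_prod card_ord lee_fin.
by rewrite -[leRHS]mulr_natl natrM -expr2.
Qed.

(** For r >= 1/6 the right side exceeds 1. Otherwise the packing with m the integer part of 1/(6r)
    gives 1/m^2, and m >= 1/(12r) because m + 1 <= 2m. *)
Lemma ball_mass_upper p r : unit_sphere p -> 0 < r ->
  fine (mu (chordal_ball p r)) <= 144 * r ^+ 2.
Proof.
move=> hp r0; have [r6|r6] := leP 6^-1 r.
  have : fine (mu (chordal_ball p r)) <= 1 by rewrite -lee_fin -mu_ball_fin mu_ball_le1.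
  by move=> /le_trans; apply; nra.
pose m := Num.trunc (6 * r)^-1.
have t0 : 0 <= (6 * r)^-1 by rewrite invr_ge0 mulr_ge0// ltW.
have /andP[m1 m2] := truncn_itv t0.
rewrite -/m in m1 m2.
have m_gt0 : (0 < m)%N.
  rewrite -(ltr_nat R); have : 1 < m.+1%:R :> R; last by rewrite -natr1 ltrDr.
  by apply: lt_trans m2; rewrite invf_gt1 ?mulr_gt0//; lra.
have m0 : 0 < m%:R :> R by rewrite ltr0n.
have rm : r <= (6 * m%:R)^-1.
  rewrite -[r]invrK lef_pV2 ?posrE ?invr_gt0 ?mulr_gt0//.
  by rewrite mulrC -ler_pdivlMr// -invfM mulrC.
apply: le_trans (ball_mass_mono p rm) _.
have := ball_packing hp m_gt0; rewrite -ler_pdivlMl ?exprn_gt0// mulr1 => /le_trans; apply.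
rewrite -ler_pV2 ?inE ?unitf_gt0 ?invr_gt0 ?exprn_gt0 ?mulr_gt0 ?exprn_gt0// invrK.
have h1 : m.+1%:R <= 2 * m%:R :> R by rewrite -natr1 mulr_natl mulr2n lerD2l (ler_nat R 1).
have h2 : (12 * r)^-1 <= m%:R.
  have : (6 * r)^-1 <= 2 * m%:R by apply: ltW; apply: lt_le_trans h1.
  by rewrite !invfM; lra.
have -> : (144 * r ^+ 2)^-1 = (12 * r)^-1 ^+ 2 by field; rewrite gt_eqF.
by rewrite lerXn2r ?nnegrE// invr_ge0 mulr_ge0// ltW.
Qed.

(* Applied on the six pieces of the sphere where a given coordinate has a given
   sign and a square at least 1/3: there the sphere is a Lipschitz graph. *)
Lemma graph_coordinate_lipschitz (a b e a' b' e' h : R) :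
  a ^+ 2 + b ^+ 2 + e ^+ 2 = 1 -> a' ^+ 2 + b' ^+ 2 + e' ^+ 2 = 1 ->
  3^-1 <= a ^+ 2 -> 3^-1 <= a' ^+ 2 -> 0 <= a * a' ->
  `|b - b'| <= h -> `|e - e'| <= h ->
  (a - a') ^+ 2 + (b - b') ^+ 2 + (e - e') ^+ 2 <= (6 * h) ^+ 2.
Proof.
move=> s1 s2 a1 a2 aa bh eh.
have h0 : 0 <= h by apply: le_trans bh.
have sq_le (x y : R) : 0 <= y -> `|x| <= y -> x ^+ 2 <= y ^+ 2.
  by move=> y0 xy; rewrite -real_normK ?num_real// lerXn2r ?nnegrE.
have le1 (x y z : R) : x ^+ 2 + y ^+ 2 + z ^+ 2 = 1 -> `|y| <= 1 /\ `|z| <= 1.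
  move=> xyz; have := sqr_ge0 x; have := sqr_ge0 y; have := sqr_ge0 z.
  by split; rewrite -ler_sqr ?nnegrE// expr1n real_normK ?num_real//; lra.
have [b1 e1] := le1 _ _ _ s1; have [b2 e2] := le1 _ _ _ s2.
have prod x y : `|x| <= 1 -> `|y| <= 1 -> `|x - y| <= h ->
    `|x ^+ 2 - y ^+ 2| <= 2 * h.
  move=> x1 y1 xy; rewrite subr_sqr normrM mulrC ler_pM//.
  by rewrite (le_trans (ler_normD _ _))// -[2]/(1 + 1) lerD.
have key : ((a - a') * (a + a')) ^+ 2 <= (4 * h) ^+ 2.
  apply: sq_le; first by rewrite mulr_ge0.
  have -> : (a - a') * (a + a') = - ((b ^+ 2 - b' ^+ 2) + (e ^+ 2 - e' ^+ 2)).
    have -> : (a - a') * (a + a') = a ^+ 2 - a' ^+ 2 by ring.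
    by move: s1 s2; clear; lra.
  rewrite normrN (le_trans (ler_normD _ _))//.
  rewrite (_ : 4 * h = 2 * h + 2 * h); last by ring.
  by rewrite lerD// prod.
have h2b : (b - b') ^+ 2 <= h ^+ 2 by exact: sq_le.
have h2e : (e - e') ^+ 2 <= h ^+ 2 by exact: sq_le.
have sum2 : 2 * 3^-1 <= (a + a') ^+ 2.
  have -> : (a + a') ^+ 2 = a ^+ 2 + a' ^+ 2 + 2 * (a * a') by ring.
  by move: a1 a2 aa; clear; lra.
(* Dividing (4h)^2 by the lower bound 2/3 of (a + a')^2; the three squares then add up to at most 26
   h^2, below 36 h^2. *)
have h2a : (a - a') ^+ 2 <= 24 * h ^+ 2.
  have : (a - a') ^+ 2 * (2 * 3^-1) <= 16 * h ^+ 2.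
    apply: le_trans (ler_wpM2l (sqr_ge0 _) sum2) _.
    by rewrite -exprMn (le_trans key)// exprMn; lra.
  by clear; lra.
have -> : (6 * h) ^+ 2 = 36 * h ^+ 2 by ring.
by have := sqr_ge0 h; move: h2a h2b h2e; clear; lra.
Qed.

(* Six graph charts, each cut by a grid of mesh 1/m. *)
Lemma sphere_cells (m : nat) : (0 < m)%N ->
  exists cell : 3.-tuple R -> 'I_3 * bool * 'I_(2 * m).+1 * 'I_(2 * m).+1,
    forall x y, unit_sphere x -> unit_sphere y -> cell x = cell y ->
      chordal_dist x y <= 6 / m%:R.
Proof.
move=> m0; have m_gt0 : 0 < m%:R :> R by rewrite ltr0n.
pose big (x : 3.-tuple R) : 'I_3 := if 3^-1 <= tnth x i0 ^+ 2 then i0 else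
  if 3^-1 <= tnth x i1 ^+ 2 then i1 else i2.
(* On the sphere m (x_k + 1) lies in [0, 2m], so its integer part is a valid index and [inord] keeps
   it. *)
pose slot (x : 3.-tuple R) (k : 'I_3) : 'I_(2 * m).+1 :=
  inord (Num.trunc (m%:R * (tnth x k + 1))).
pose cell x := (big x, 0 <= tnth x (big x), slot x (big x + 1), slot x (big x + 2)).
have big_sqr x : unit_sphere x -> 3^-1 <= tnth x (big x) ^+ 2.
  rewrite /unit_sphere /= sum3E /big => hx.
  case: ifPn => [//|]; rewrite -ltNge => h0.
  case: ifPn => [//|]; rewrite -ltNge => h1.
  by move: hx h0 h1; clear; lra.
have coord_le1 (x : 3.-tuple R) k : unit_sphere x -> -1 <= tnth x k <= 1.
  rewrite /unit_sphere /= => hx; rewrite -ler_norml.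
  rewrite -ler_sqr ?nnegrE// expr1n real_normK ?num_real// -hx (bigD1 k)//=.
  by rewrite lerDl sumr_ge0// => i _; rewrite sqr_ge0.
have slot_close x y k : unit_sphere x -> unit_sphere y -> slot x k = slot y k ->
    `|tnth x k - tnth y k| <= m%:R^-1.
  move=> hx hy /(congr1 val) /=.
  have bnd (z : 3.-tuple R) : unit_sphere z -> 0 <= m%:R * (tnth z k + 1) /\
      (Num.trunc (m%:R * (tnth z k + 1)) < (2 * m).+1)%N.
    move=> hz; have /andP[z1 z2] := coord_le1 _ k hz.
    have z0 : 0 <= m%:R * (tnth z k + 1) by rewrite mulr_ge0// -lerBlDr sub0r.
    split=> //; rewrite ltnS -(ler_nat R).
    have /andP[t1 _] := truncn_itv z0; apply: le_trans t1 _.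
    rewrite mulrC natrM ler_pM2r//; move: z2; clear; lra.
  have [x0 xb] := bnd x hx; have [y0 yb] := bnd y hy.
  rewrite !inordK// => xy.
  suff : `|m%:R * (tnth x k + 1) - m%:R * (tnth y k + 1)| <= 1 :> R.
    rewrite -mulrBr opprD addrACA subrr addr0 normrM ger0_norm//.
    by rewrite -ler_pdivlMl// mulr1.
  have := truncn_itv x0; have := truncn_itv y0; rewrite xy -natr1.
  move: (m%:R * _) (m%:R * _) (_%:R) => u v t /andP[y1 y2] /andP[x1 x2].
  by rewrite ler_norml; apply/andP; split; move: y1 y2 x1 x2; clear; lra.
exists cell => x y hx hy [bxy sxy s1 s2].
rewrite chordal_le ?divr_ge0//.
have := big_sqr _ hx; have := big_sqr _ hy; rewrite -bxy in sxy s1 s2 *.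
move: (slot_close _ _ _ hx hy s1) (slot_close _ _ _ hx hy s2) => c1 c2 ay ax.
have ss : 0 <= tnth x (big x) * tnth y (big x).
  move: sxy; case: (leP 0 (tnth x (big x))) => h1 /esym h2; first by rewrite mulr_ge0.
  by move/negbT: h2; rewrite -ltNge => h2; rewrite mulr_le0 ?(ltW h1) ?(ltW h2).
have cyc (F : 'I_3 -> R) k : \sum_(i < 3) F i = F k + F (k + 1) + F (k + 2).
  rewrite sum3E; have [->|->|->] := ord3P k.
  - by congr (F _ + F _ + F _); exact: val_inj.
  - by rewrite -addrA addrC; congr (F _ + F _ + F _); exact: val_inj.
  - by rewrite addrC addrA; congr (F _ + F _ + F _); exact: val_inj.
rewrite (cyc _ (big x)); apply: graph_coordinate_lipschitz => //.
- by rewrite -(cyc (fun i => tnth x i ^+ 2)).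
- by rewrite -(cyc (fun i => tnth y i ^+ 2)).
Qed.

(** Each nonempty cell lies in a ball around one of its points, and there are 6 (2m + 1)^2 <= 54 m^2
    cells. Empty cells get the center p. *)
Lemma ball_covering p (m : nat) : unit_sphere p -> (0 < m)%N ->
  1 <= 54 * m%:R ^+ 2 * fine (mu (chordal_ball p (6 / m%:R))) :> R.
Proof.
move=> hp m0; have [cell cellP] := sphere_cells m0.
pose I := ('I_3 * bool * 'I_(2 * m).+1 * 'I_(2 * m).+1)%type.
have : forall i : I, exists z, unit_sphere z /\
    forall x, unit_sphere x -> cell x = i -> chordal_ball z (6 / m%:R) x.
  move=> i; have [[z [hz zi]]|no] := pselect (exists z, unit_sphere z /\ cell z = i).
    by exists z; split=> // x hx xi; apply: cellP => //; rewrite xi.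
  by exists p; split=> // x hx xi; case: no; exists x.
move/fin_all_exists => [z zP].
have := @integral_le_sum _ _ R mu unit_sphere measurable_unit_sphere _ (enum {: I})
  (fun i => chordal_ball (z i) (6 / m%:R)) (fun=> 1)
  (fun i => measurable_chordal_ball _ _) (fun=> ler01) (fun=> 1)
  (measurable_cst _).
have -> : (\int[mu]_(x in unit_sphere) (1 : R)%:E = 1)%E.
  by rewrite integral_cst ?mul1e; [exact: mu_inv.1|exact: measurable_unit_sphere].
move=> H; rewrite -lee_fin; apply: le_trans (H _ _) _ => //.
  move=> x hx; apply: (le_sum_indic (i := cell x)) => //.
    by rewrite mem_enum.
  exact: (zP _).2.
rewrite (@le_trans _ _ (\sum_(i <- enum {: I}) (fine (mu (chordal_ball p (6 / m%:R))))%:E)%E)//.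
  apply: lee_sum => i _; rewrite mul1e.
  rewrite -(mu_ball_fin p) (mu_ball_eq _ hp (zP i).1).
  apply: le_measure; rewrite ?inE; last exact: subIsetl.
    apply: measurableI; [exact: measurable_chordal_ball|exact: measurable_unit_sphere].
  exact: measurable_chordal_ball.
rewrite sumEFin big_enum sumr_const /= !card_prod !card_ord card_bool lee_fin.
rewrite -[leLHS]mulr_natl ler_wpM2r ?fine_ge0// -natrX -natrM ler_nat.
by move: m0; clear; nia.
Qed.

(** The covering is used with m one more than the integer part of 6/r, so that 6/m <= r and, as r <=
    1, m <= 7/r. *)
Lemma ball_mass_lower p r : unit_sphere p -> 0 < r -> r <= 1 ->
  r ^+ 2 / (54 * 7 ^+ 2) <= fine (mu (chordal_ball p r)).
Proof.
move=> hp r0 r1; pose m := (Num.trunc (6 / r)).+1.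
have t0 : 0 <= 6 / r by rewrite divr_ge0// ltW.
have /andP[m1 m2] := truncn_itv t0.
rewrite -/m in m2; have m0 : 0 < m%:R :> R by rewrite ltr0n.
have rm : 6 / m%:R <= r by rewrite ler_pdivrMr// mulrC -ler_pdivrMr// ltW.
have mr : m%:R <= 7 / r.
  have -> : 7 / r = 6 / r + r^-1 by field; rewrite gt_eqF.
  by rewrite /m -[leLHS]natr1 lerD// invf_ge1.
apply: le_trans (ball_mass_mono p rm).
have := ball_covering hp (ltn0Sn _ : (0 < m)%N); rewrite -/m.
set t := fine _ => h.
have t_ge0 : 0 <= t by rewrite fine_ge0.
have h2 : 54 * m%:R ^+ 2 * t <= 54 * (7 / r) ^+ 2 * t.
  by rewrite ler_wpM2r// ler_wpM2l// lerXn2r ?nnegrE ?divr_ge0// ltW.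
have h3 := le_trans h h2.
have E : 54 * (7 / r) ^+ 2 * t = 54 * 7 ^+ 2 * t / r ^+ 2.
  by rewrite expr_div_n; ring.
rewrite ler_pdivrMr ?mulr_gt0 ?exprn_gt0// [leRHS]mulrC.
by move: h3; rewrite E ler_pdivlMr ?exprn_gt0// mul1r.
Qed.

End sphere_regularity.

(** * The mass of clustered configurations *)

Section product_power_cons.
Context d (T : measurableType d) (R : realType) (P : probability T R).

(** Uniqueness of the product measure puts the integral over the new point inside, with the other
    points fixed. *)
Lemma product_powerS n (A : set (n.+1.-tuple T)) : measurable A ->
  (product_power P n.+1 A =
   \int[product_power P n]_t P [set x | A (tuple_cons (x, t))])%E.
Proof.
move=> mA; have mA' : measurable (@tuple_cons _ T n @^-1` A).
  by rewrite -[X in measurable X]setTI; exact: measurable_tuple_cons.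
transitivity ((P \x product_power P n)%E (@tuple_cons _ T n @^-1` A)); first by [].
rewrite (product_measure_unique (m' := (P \x^ product_power P n)%E))//.
  apply: eq_integral => t _ /=; congr (P _).
  by apply/seteqP; split=> x; rewrite /ysection /= inE.
by move=> *; exact: product_measure2E.
Qed.

Lemma measurable_section n (A : set (n.+1.-tuple T)) t : measurable A ->
  measurable [set x | A (tuple_cons (x, t))].
Proof.
move=> mA; have mA' : measurable (@tuple_cons _ T n @^-1` A).
  by rewrite -[X in measurable X]setTI; exact: measurable_tuple_cons.
rewrite (_ : [set x | _] = ysection (@tuple_cons _ T n @^-1` A) t).
  exact: measurable_ysection.
by apply/seteqP; split=> x; rewrite /ysection /= inE.
Qed.

Lemma measurable_fun_section n (A : set (n.+1.-tuple T)) : measurable A ->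
  measurable_fun setT (fun t => P [set x | A (tuple_cons (x, t))]).
Proof.
move=> mA; have mA' : measurable (@tuple_cons _ T n @^-1` A).
  by rewrite -[X in measurable X]setTI; exact: measurable_tuple_cons.
rewrite (_ : (fun t => _) = P \o ysection (@tuple_cons _ T n @^-1` A)).
  exact: measurable_fun_ysection.
apply/funext => t /=; congr (P _).
by apply/seteqP; split=> x; rewrite /ysection /= inE.
Qed.

Lemma product_power_ge n (A : set (n.+1.-tuple T)) (B : set (n.-tuple T)) (v : R) :
  measurable A -> measurable B -> 0 <= v ->
  (forall t, B t -> (v%:E <= P [set x | A (tuple_cons (x, t))])%E) ->
  (v%:E * product_power P n B <= product_power P n.+1 A)%E.
Proof.
move=> mA mB v0 h; rewrite product_powerS// -integral_cst//.
apply: (@le_trans _ _ (\int[product_power P n]_(t in B) P [set x | A (tuple_cons (x, t))])%E).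
  apply: ge0_le_integral => //.
  by apply: measurable_funTS; exact: measurable_fun_section.
by apply: ge0_subset_integral => //; exact: measurable_fun_section.
Qed.

Lemma product_power_le n (A : set (n.+1.-tuple T)) (B : set (n.-tuple T)) (v : R) :
  measurable A -> measurable B -> 0 <= v ->
  (forall x t, A (tuple_cons (x, t)) -> B t) ->
  (forall t, B t -> (P [set x | A (tuple_cons (x, t))] <= v%:E)%E) ->
  (product_power P n.+1 A <= v%:E * product_power P n B)%E.
Proof.
move=> mA mB v0 hB h; rewrite product_powerS// -integral_cst//.
rewrite [leRHS]integral_mkcond; apply: ge0_le_integral => //.
- exact: measurable_fun_section.
- by apply/(measurable_restrictT _ _).1 => //; exact: measurable_cst.
move=> t _; rewrite patchE; case: ifPn => [/set_mem/h//|/negP tB].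
rewrite (_ : [set x | _] = set0) ?measure0//.
by apply/seteqP; split=> x //= /hB Bt; apply: tB; rewrite inE.
Qed.

End product_power_cons.

(** * Configurations with pairwise distances prescribed up to constants *)

Section configurations.
Context {R : realType}.
Variable mu : probability (3.-tuple R) R.
Hypothesis mu_inv : invariant_sphere_probability mu.
Variables Cu cl : R.
Hypothesis Cu_gt0 : 0 < Cu.
Hypothesis ball_upper : forall p r, unit_sphere p -> 0 < r ->
  fine (mu (chordal_ball p r)) <= Cu * r ^+ 2.
Hypothesis ball_lower : forall p r, unit_sphere p -> 0 < r -> r <= 1 ->
  cl * r ^+ 2 <= fine (mu (chordal_ball p r)).
Variable lam : R.
Hypothesis lam_gt0 : 0 < lam.

Definition scale (n : nat) : R := expR (- (lam * n%:R)).

Lemma scale_gt0 n : 0 < scale n. Proof. exact: expR_gt0. Qed.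

Lemma scale_mono n n' : (n <= n')%N -> scale n' <= scale n.
Proof. by move=> nn; rewrite ler_expR lerN2 ler_pM2l// ler_nat. Qed.

Lemma scale0 : scale 0 = 1. Proof. by rewrite /scale mulr0 oppr0 expR0. Qed.

Lemma scale_le1 n : scale n <= 1. Proof. by rewrite -scale0 scale_mono. Qed.

Lemma scaleS n : scale n.+1 = scale 1 * scale n.
Proof. by rewrite /scale -expRD -opprD -mulrDr nat1r. Qed.

(** For [a = scale 1] and [b = 1] the half-open windows of different levels are disjoint; a negative
    [a] removes the lower bound. *)
Definition config_set m (n : 'I_m -> 'I_m -> nat) (a b : R) :
    set (m.-tuple (3.-tuple R)) :=
  [set t | (forall i, unit_sphere (tnth t i)) /\
     forall i j : 'I_m, (i < j)%N ->
       a * scale (n i j) < chordal_dist (tnth t i) (tnth t j) <= b * scale (n i j)].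

Lemma measurable_forall d (T : measurableType d) (I : finType) (F : I -> set T) :
  (forall i, measurable (F i)) -> measurable [set t | forall i, F i t].
Proof.
move=> mF; rewrite (_ : [set t | _] = \bigcap_(i in [set: I]) F i).
  by apply: fin_bigcap_measurable => //; exact: finite_finset.
by apply/seteqP; split=> t /= h i => [_|]; apply: h.
Qed.

Lemma measurable_sphere_tuples m :
  measurable [set t : m.-tuple (3.-tuple R) | forall i, unit_sphere (tnth t i)].
Proof.
apply: measurable_forall => i; rewrite -[X in measurable X]setTI.
by apply: (measurable_tnth i) => //; exact: measurable_unit_sphere.
Qed.

Lemma measurable_dist_tnth m (i j : 'I_m) : measurable_fun setT
  (fun t : m.-tuple (3.-tuple R) => chordal_dist (tnth t i) (tnth t j)).
Proof. by apply: measurable_chordal; exact: measurable_tnth. Qed.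

Lemma measurable_config_set m (n : 'I_m -> 'I_m -> nat) a b :
  measurable (config_set n a b).
Proof.
apply: measurableI; first exact: measurable_sphere_tuples.
apply: measurable_forall => i; apply: measurable_forall => j.
have [ij|nij] := boolP (i < j)%N; last first.
  rewrite [X in measurable X](_ : _ = setT); first exact: measurableT.
  by apply/seteqP; split.
rewrite [X in measurable X](_ : _ = setT `&`
   (fun t : m.-tuple (3.-tuple R) => chordal_dist (tnth t i) (tnth t j)) @^-1`
   `]a * scale (n i j), b * scale (n i j)]%classic).
  by apply: measurable_dist_tnth.
rewrite setTI; apply/seteqP; split=> t /=; rewrite in_itv /=.
  exact.
by move=> ->.
Qed.

Definition tail_levels m (n : 'I_m.+1 -> 'I_m.+1 -> nat) (i j : 'I_m) :=
  n (lift ord0 i) (lift ord0 j).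

(** The scale at which the point j is placed, the points of larger index being there already; it is
    0 for the first point placed. *)
Definition top_level m (n : 'I_m -> 'I_m -> nat) (j : 'I_m) : nat :=
  \max_(i < m | (j < i)%N) n j i.

Lemma top_level0 m (n : 'I_m.+1 -> 'I_m.+1 -> nat) :
  top_level n ord0 = \max_(i < m) n ord0 (lift ord0 i).
Proof. by rewrite /top_level big_mkcond big_ord_recl /= max0n. Qed.

Lemma top_level_lift m (n : 'I_m.+1 -> 'I_m.+1 -> nat) (j : 'I_m) :
  top_level n (lift ord0 j) = top_level (tail_levels n) j.
Proof.
rewrite /top_level big_mkcond big_ord_recl /= max0n [RHS]big_mkcond.
by apply: eq_bigr => i _; rewrite /= /bump /= !add1n ltnS.
Qed.

Lemma config_set_cons m (n : 'I_m.+1 -> 'I_m.+1 -> nat) a b x t :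
  config_set n a b (tuple_cons (x, t)) <->
  [/\ config_set (tail_levels n) a b t, unit_sphere x &
     forall i : 'I_m, a * scale (n ord0 (lift ord0 i)) <
       chordal_dist x (tnth t i) <= b * scale (n ord0 (lift ord0 i))].
Proof.
have t0 : tnth (tuple_cons (x, t)) ord0 = x by exact: tnth0.
have tS i : tnth (tuple_cons (x, t)) (lift ord0 i) = tnth t i by exact: tnthS.
split=> [[h1 h2]|[[h1 h2] hx h3]].
- split; [split|by rewrite -t0|] => [i|i j ij|i].
  + by rewrite -tS.
  + by have := h2 (lift ord0 i) (lift ord0 j) ij; rewrite !tS.
  + by have := h2 ord0 (lift ord0 i) isT; rewrite tS t0.
- split=> [i|i j]; first by case: (unliftP ord0 i) => [k|] ->; rewrite ?tS ?t0.
  case: (unliftP ord0 i) => [k|] ->; case: (unliftP ord0 j) => [l|] -> //.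
  + by rewrite /= /bump /= !add1n ltnS !tS => /h2.
  + by rewrite t0 tS => _; exact: h3.
Qed.

Lemma mu_sphereC : mu (~` unit_sphere) = 0%E.
Proof.
by rewrite probability_setC ?mu_inv.1 ?subee//; exact: measurable_unit_sphere.
Qed.

(* The other points being fixed, the new one lies in a ball around the one to
   which it is closest. *)
Lemma config_set_upper m (n : 'I_m -> 'I_m -> nat) a b : 0 < b ->
  (product_power mu m (config_set n a b) <=
   (\prod_(j < m) ((1 + Cu * b ^+ 2) * scale (top_level n j) ^+ 2))%:E)%E.
Proof.
move=> b0; elim: m n => [|m IH] n.
  rewrite big_ord0; apply: probability_le1; exact: measurable_config_set.
rewrite big_ord_recl EFinM.
have v0 : 0 <= (1 + Cu * b ^+ 2) * scale (top_level n ord0) ^+ 2.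
  by rewrite mulr_ge0 ?sqr_ge0// addr_ge0 ?mulr_ge0 ?sqr_ge0// ltW.
apply: (@le_trans _ _ (((1 + Cu * b ^+ 2) * scale (top_level n ord0) ^+ 2)%:E
   * product_power mu m (config_set (tail_levels n) a b))%E); last first.
  rewrite lee_wpmul2l ?lee_fin//; apply: le_trans (IH _) _.
  by rewrite lee_fin; under [leRHS]eq_bigr do rewrite top_level_lift.
apply: product_power_le => //; [exact: measurable_config_set|exact: measurable_config_set| |].
  by move=> x t /config_set_cons[].
move=> t [tS _]; rewrite top_level0.
have mS := measurable_section t (measurable_config_set n a b).
(* The first point placed has no neighbour and scale 1: the summand 1 of the constant covers it. *)
case: m n v0 t tS mS {IH} => [|m] n v0 t tS mS.
  rewrite big_ord0 scale0 expr1n mulr1 (le_trans (probability_le1 _ _))//.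
  by rewrite lee_fin lerDl mulr_ge0 ?sqr_ge0// ltW.
have [|i0 ->] := @bigop.eq_bigmax _ (fun i : 'I_m.+1 => n ord0 (lift ord0 i)).
  by rewrite card_ord.
set s := scale _; have s0 : 0 < s := scale_gt0 _.
apply: (@le_trans _ _ (mu (chordal_ball (tnth t i0) (b * s)))).
  apply: le_measure; rewrite ?inE//; first exact: measurable_chordal_ball.
  by move=> x /config_set_cons[_ _ /(_ i0)/andP[]].
rewrite mu_ball_fin lee_fin (le_trans (ball_upper (tS _) _)) ?mulr_gt0//.
by rewrite exprMn mulrA ler_wpM2r ?sqr_ge0// lerDr.
Qed.

Section lower_bound.
Variables (N : nat) (gam del kap : R).
Hypothesis gam_gt0 : 0 < gam.
Hypothesis gam_le1 : gam <= 1.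
Hypothesis del_gt0 : 0 < del.
Hypothesis kap_ge0 : 0 <= kap.
Hypothesis kap_le1 : kap <= 1.
(** A ball of radius gam s keeps mass at least kap s^2 after the removal of at most N balls of
    radius del s. *)
Hypothesis room : kap + N%:R * (Cu * del ^+ 2) <= cl * gam ^+ 2.

(* The new point is put close to one of the points of highest common level with
   it, away from smaller balls around all the points. *)
Lemma config_set_lower m (n : 'I_m -> 'I_m -> nat) : (m <= N)%N ->
  (forall i j, n i j = n j i) ->
  (forall i j k, (minn (n i j) (n j k) <= n i k)%N) ->
  ((\prod_(j < m) (kap * scale (top_level n j) ^+ 2))%:E <=
   product_power mu m
     (config_set n (del - m%:R * (gam * scale 1)) (m%:R * gam)))%E.
Proof.
elim: m n => [|m IH] n mN symn ultn.
  rewrite big_ord0 (_ : config_set _ _ _ = setT) ?probability_setT//.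
  by apply/seteqP; split=> // t _; split=> -[].
rewrite big_ord_recl EFinM.
have v0 : 0 <= kap * scale (top_level n ord0) ^+ 2 by rewrite mulr_ge0// sqr_ge0.
(* Each new point costs one triangle inequality: the window grows by [gam] above and by
   [gam * scale 1] below. *)
set a := del - m.+1%:R * _; set b := m.+1%:R * gam.
pose a' := del - m%:R * (gam * scale 1); pose b' := m%:R * gam.
apply: (@le_trans _ _ ((kap * scale (top_level n ord0) ^+ 2)%:E
   * product_power mu m (config_set (tail_levels n) a' b'))%E).
  rewrite lee_wpmul2l ?lee_fin//.
  under eq_bigr do rewrite top_level_lift.
  apply: IH; first exact: ltnW.
    by move=> i j; exact: symn.
  by move=> i j k; exact: ultn.
have aa' : a = a' - gam * scale 1.
  by rewrite /a /a' -natr1 mulrDl mul1r opprD addrA.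
have bb' : b = b' + gam by rewrite /b /b' -natr1 mulrDl mul1r.
have ale : a' <= del by rewrite gerBl mulr_ge0// mulr_ge0 ?(ltW gam_gt0) ?(ltW (scale_gt0 _)).
have g1 : 0 < gam * scale 1 by rewrite mulr_gt0 ?scale_gt0.
apply: product_power_ge => //; [exact: measurable_config_set|exact: measurable_config_set|].
move=> t tB; have [tS tD] := tB; rewrite top_level0.
have mA := measurable_section t (measurable_config_set n a b).
set S := [set x | _] in mA *.
have [m0|m0] := posnP m.
  have noI (i : 'I_m) : False by have := ltn_ord i; rewrite [X in (_ < X)%N]m0.
  rewrite big1 ?scale0 ?expr1n ?mulr1; last by move=> i; case: (noI i).
  apply: (@le_trans _ _ (mu unit_sphere)); first by rewrite mu_inv.1 lee_fin.
  apply: le_measure; rewrite ?inE//; first exact: measurable_unit_sphere.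
  move=> x hx; apply/config_set_cons; split=> //.
have [|i0 nmax] := @bigop.eq_bigmax _ (fun i : 'I_m => n ord0 (lift ord0 i)).
  by rewrite card_ord.
have nmax' i : (n ord0 (lift ord0 i) <= n ord0 (lift ord0 i0))%N.
  by rewrite -nmax; exact: bigop.leq_bigmax.
rewrite nmax; set s := scale _; have s0 : 0 < s := scale_gt0 _.
(* The ball around the closest point is covered by the admissible positions [S], the null complement
   of the sphere and the excluded balls; this bounds the mass of [S] from below. *)
pose F (o : option (option 'I_m)) := match o with
  | None => S | Some None => ~` unit_sphere
  | Some (Some i) => chordal_ball (tnth t i) (del * s) end.
have mF o : measurable (F o).
  case: o => [[i|]|] //=; first exact: measurable_chordal_ball.
  by apply: measurableC; exact: measurable_unit_sphere.
have cover x : chordal_ball (tnth t i0) (gam * s) x -> exists o, F o x.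
  move=> xb; have [hx|nx] := pselect (unit_sphere x); last by exists (Some None).
  have [[i xi]|far] := pselect (exists i, chordal_ball (tnth t i) (del * s) x).
    by exists (Some (Some i)).
  exists None; apply/config_set_cons; split=> //.
    split=> // i j ij; have /andP[d1 d2] := tD i j ij; apply/andP; split.
      apply: le_lt_trans d1; rewrite ler_wpM2r ?(ltW (scale_gt0 _))//.
      by rewrite aa' gerBl ltW.
    by apply: le_trans d2 _; rewrite ler_wpM2r ?(ltW (scale_gt0 _))// bb' lerDl ltW.
  move=> i; have fi : del * s < chordal_dist x (tnth t i).
    by rewrite ltNge; apply/negP => h; apply: far; exists i.
  have xb' : chordal_dist x (tnth t i0) <= gam * s := xb.
  have b'_ge0 : 0 <= b' by rewrite /b' mulr_ge0// ltW.
  have [ii0|ii0] := eqVneq i i0.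
    subst i; rewrite -/s; apply/andP; split.
      apply: le_lt_trans fi; rewrite ler_pM2r// aa'; apply: le_trans ale.
      by rewrite gerBl ltW.
    by apply: le_trans xb' _; rewrite ler_pM2r// bb' lerDr.
  have dd : a' * scale (n (lift ord0 i0) (lift ord0 i)) <
      chordal_dist (tnth t i0) (tnth t i) <=
      b' * scale (n (lift ord0 i0) (lift ord0 i)).
    case: (ltngtP i i0) => h; last by move/val_inj: h => h; rewrite h eqxx in ii0.
      by rewrite chordalC symn; exact: tD.
    exact: tD.
  have nle : (n ord0 (lift ord0 i) <= n (lift ord0 i0) (lift ord0 i))%N.
    apply: leq_trans (ultn _ ord0 _); rewrite leq_min leqnn andbT [n _ ord0]symn.
    exact: nmax'.
  have /andP[dl du] := dd.
  apply/andP; split; last first.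
    rewrite (le_trans (chordal_triangle (tnth t i0) _ _))// bb' addrC mulrDl.
    apply: lerD.
      by apply: le_trans du _; rewrite ler_wpM2l// scale_mono.
    by apply: le_trans xb' _; rewrite ler_pM2l// scale_mono.
  (* At the top level the lower bound comes from the excluded ball around i. At a lower level the
     ultrametric inequality gives i the same level to i0 as to the new point, whose distance to i0
     is smaller by a factor [scale 1]. *)
  have := nmax' i; rewrite leq_eqVlt => /orP[/eqP nn|nlt].
    rewrite nn; apply: le_lt_trans fi; rewrite ler_pM2r// aa'; apply: le_trans ale.
    by rewrite gerBl ltW.
  have nn : n (lift ord0 i0) (lift ord0 i) = n ord0 (lift ord0 i).
    apply/eqP; rewrite eqn_leq nle andbT leqNgt; apply/negP => h.
    have := ultn ord0 (lift ord0 i0) (lift ord0 i).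
    by rewrite leqNgt leq_min nlt h.
  rewrite nn in dl; set s' := scale (n ord0 (lift ord0 i)) in dl *.
  have ss' : s <= scale 1 * s'.
    by rewrite /s /s' -scaleS scale_mono.
  have tri := chordal_triangle x (tnth t i0) (tnth t i).
  rewrite aa' mulrBl ltrBlDr (lt_le_trans dl)// (le_trans tri)// addrC lerD2l.
  rewrite chordalC (le_trans xb')// -mulrA ler_pM2l//.
have mball := measurable_chordal_ball (tnth t i0) (gam * s).
pose os : seq (option (option 'I_m)) :=
  [:: None, Some None & [seq Some (Some i) | i <- enum 'I_m]].
have osP o : o \in os.
  case: o => [[i|]|]; rewrite !inE//= map_f ?mem_enum//.
have := @integral_le_sum _ _ R mu _ mball _ os
  F (fun=> 1) mF (fun=> ler01) (fun=> 1) (measurable_cst _).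
rewrite integral_cst// mul1e => H.
have {}H : (mu (chordal_ball (tnth t i0) (gam * s)) <=
    \sum_(o <- os) 1%:E * mu (F o `&` chordal_ball (tnth t i0) (gam * s)))%E.
  apply: H => // x /cover[u Fu].
  exact: (le_sum_indic (i := u)).
rewrite !big_cons !mul1e big_map in H.
have SE : mu S = (fine (mu S))%:E by rewrite fineK// fin_num_measure.
have bigE : cl * (gam * s) ^+ 2 <= fine (mu S) + \sum_(i : 'I_m) Cu * (del * s) ^+ 2.
  rewrite -lee_fin; apply: (@le_trans _ _ (mu (chordal_ball (tnth t i0) (gam * s)))).
    rewrite mu_ball_fin lee_fin ball_lower ?mulr_gt0//.
    by rewrite mulr_ile1 ?scale_le1 ?(ltW gam_gt0) ?(ltW s0).
  apply: (le_trans H); rewrite EFinD -SE; apply: leeD.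
    by apply: le_measure; rewrite ?inE//; exact: measurableI.
  rewrite -[leRHS]add0e; apply: leeD.
    rewrite -mu_sphereC; apply: le_measure; rewrite ?inE; last exact: subIsetl.
      by apply: measurableI => //; apply: measurableC; exact: measurable_unit_sphere.
    by apply: measurableC; exact: measurable_unit_sphere.
  rewrite -sumEFin big_enum; apply: lee_sum => i _; rewrite mul1e.
  apply: (@le_trans _ _ (mu (chordal_ball (tnth t i) (del * s)))).
    apply: le_measure; rewrite ?inE; last exact: subIsetl.
      by apply: measurableI => //; exact: measurable_chordal_ball.
    exact: measurable_chordal_ball.
  by rewrite mu_ball_fin lee_fin ball_upper ?mulr_gt0.
rewrite SE lee_fin; move: bigE; rewrite sumr_const card_ord -lerBlDr.
apply: le_trans; rewrite lerBrDr -mulr_natl !exprMn.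
apply: (@le_trans _ _ ((kap + N%:R * (Cu * del ^+ 2)) * s ^+ 2)); last first.
  by rewrite [leRHS]mulrA ler_wpM2r ?sqr_ge0.
rewrite mulrDl lerD2l -[leRHS]mulrA -[Cu * _ * _]mulrA ler_wpM2r//.
  by apply: mulr_ge0; [exact: ltW|rewrite -exprMn sqr_ge0].
by rewrite ler_nat ltnW.
Qed.

End lower_bound.
End configurations.

(** * The integrand on clustered configurations *)

(** A decreasing predicate holds on an initial segment, so the count is the last index where it
    holds. This turns levels into bounds on distances. *)
Lemma count_iota_decreasing (P : pred nat) (M : nat) :
  (forall k, P k.+1 -> P k) ->
  ((0 < count P (iota 1 M))%N -> P (count P (iota 1 M))) /\
  ((count P (iota 1 M) < M)%N -> ~~ P (count P (iota 1 M)).+1).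
Proof.
move=> decr; have le k k' : (k <= k')%N -> P k' -> P k.
  by move=> /subnK <-; elim: (k' - k)%N => [//|j IH] /decr/IH.
elim: M => [//|M [IH1 IH2]].
rewrite (_ : iota 1 M.+1 = iota 1 M ++ [:: M.+1]); last first.
  by rewrite -{1}[M.+1]addn1 iotaD add1n.
rewrite count_cat /= addn0.
set n := count P (iota 1 M) in IH1 IH2 *.
have nM : (n <= M)%N by rewrite (leq_trans (count_size _ _))// size_iota.
have [PM|nPM] := boolP (P M.+1); last first.
  rewrite addn0; split=> // h; have [/IH2//|Mn] := ltnP n M.
  by have -> : n = M by apply/eqP; rewrite eqn_leq nM.
have nE : n = M.
  apply/eqP; rewrite eqn_leq nM leqNgt; apply/negP => h.
  by have := IH2 h; rewrite (le _ M.+1)// ltnS ltnW.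
by rewrite nE addn1 ltnn; split.
Qed.

Section components.
Context {R : realType}.
Variables (N : nat) (t : N.-tuple (3.-tuple R)).

Definition near_rel (r : R) : rel 'I_N :=
  fun i j => chordal_dist (tnth t i) (tnth t j) <= r.

Definition component_rel (r : R) : {set 'I_N * 'I_N} :=
  [set p | connect (near_rel r) p.1 p.2]%SET.

Lemma component_rel_equiv r : is_equiv (component_rel r).
Proof.
have sym : connect_sym (near_rel r).
  by apply: sym_connect_sym => i j; rewrite /near_rel chordalC.
apply/is_equivP; split=> [i|i j|i j k]; rewrite !inE /=.
- exact: connect0.
- by rewrite sym.
- exact: connect_trans.
Qed.

Lemma component_rel_mono r r' : r <= r' ->
  component_rel r \subset component_rel r'.
Proof.
move=> rr'; apply/fintype.subsetP => -[i j]; rewrite !inE /=; apply: connect_sub => x y h.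
by apply: connect1; exact: le_trans rr'.
Qed.

(** A path without repetition has fewer than N steps. *)
Lemma component_dist_le r i j : 0 <= r -> (i, j) \in component_rel r ->
  chordal_dist (tnth t i) (tnth t j) <= N%:R * r.
Proof.
move=> r0; rewrite inE /= => /connectP[p pth ->].
case/shortenP: pth => {}p pth up _.
have sp : (size p <= N)%N.
  have h : #|i :: p| = (size p).+1 by exact/card_uniqP.
  by rewrite ltnW// -h -[X in (_ <= X)%N]card_ord max_card.
apply: (@le_trans _ _ ((size p)%:R * r)); last by rewrite ler_wpM2r// ler_nat.
elim: p i pth {up sp} => [|k p IH] i /=; first by rewrite chordalxx mul0r.
move=> /andP[ik /IH h]; rewrite (le_trans (chordal_triangle (tnth t k) _ _))//.
by rewrite -nat1r mulrDl mul1r lerD.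
Qed.

Lemma near_component r i j : chordal_dist (tnth t i) (tnth t j) <= r ->
  (i, j) \in component_rel r.
Proof. by move=> h; rewrite inE /= connect1. Qed.

End components.

Section flag_of_components.
Context {R : realType}.
Variables (N : nat) (lam : R).
Hypothesis lam_gt0 : 0 < lam.

(** The flag consists of the component relations at the scales 2 q^k, k = 1, ..., M. *)
Lemma flag_covering M (t : N.-tuple (3.-tuple R)) :
  (forall i, unit_sphere (tnth t i)) ->
  (forall i j : 'I_N, (i < j)%N ->
     2 * scale lam M.+1 < chordal_dist (tnth t i) (tnth t j)) ->
  exists2 s, s \in flags M [set: 'I_N * 'I_N]%SET &
    config_set lam (level s) (2 * scale lam 1) (2 * N%:R) t.
Proof.
move=> tS tD; pose E k := component_rel t (2 * scale lam k).
have Ele k : E k.+1 \subset E k.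
  by apply: component_rel_mono; rewrite ler_pM2l// scale_mono.
have flagP m k0 (F : {set 'I_N * 'I_N}) : E k0 \subset F -> [seq E k | k <- iota k0 m] \in flags m F.
  elim: m k0 F => [|m IH] k0 F EF; first by rewrite inE.
  by rewrite mem_flagsS component_rel_equiv EF /= IH.
exists [seq E k | k <- iota 1 M]; first by apply: flagP; exact: finset.subsetT.
split=> // i j ij; rewrite /level count_map.
set P := preim _ _.
have [] := @count_iota_decreasing P M.
  by move=> k /=; apply/fintype.subsetP.
set n := count P _ => h1 h2; apply/andP; split.
  rewrite -mulrA -scaleS.
  (* At the last level the flag gives no lower bound on the distance; the separation hypothesis
     provides it. *)
  have [nM|Mn] := ltnP n M; last first.
    by apply: le_lt_trans (tD i j ij); rewrite ler_pM2l// scale_mono// ltnS.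
  rewrite ltNge; apply: contra (h2 nM); exact: near_component.
(* At level 0 the upper bound is the diameter 2 of the sphere. *)
have [n0|n0] := posnP n.
  rewrite n0 scale0 mulr1 (le_trans (chordal_sphere_le2 (tS i) (tS j)))//.
  rewrite ler_peMr// (ler_nat R 1); exact: leq_ltn_trans (ltn_ord i).
rewrite mulrAC mulrC; apply: component_dist_le; last exact: h1.
by rewrite mulr_ge0// ltW// scale_gt0.
Qed.

End flag_of_components.

Section integrand.
Context {R : realType}.
Variables (N : nat) (c : 'I_N -> 'I_N -> R) (lam : R).
Hypothesis lam_gt0 : 0 < lam.

Definition integrand (b : R) (p : N.-tuple (3.-tuple R)) : R :=
  \prod_(i < N) \prod_(j < N | (i < j)%N)
    chordal_dist (tnth p i) (tnth p j) `^ (2 * c i j * b).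

Lemma integrand_ge0 b p : 0 <= integrand b p.
Proof. by apply: prodr_ge0 => i _; apply: prodr_ge0 => j _; exact: powR_ge0. Qed.

Lemma measurable_integrand b : measurable_fun setT (integrand b).
Proof.
apply: measurable_prod => i _; under eq_fun do rewrite -big_filter.
apply: measurable_prod => j _.
apply: (@measurableT_comp _ _ _ _ _ _ (@powR R ^~ (2 * c i j * b))).
  exact: measurable_powR.
exact: measurable_dist_tnth.
Qed.

(** Writing x = e^y q^n with |y| <= L gives x^e = e^(e y) q^(n e). *)
Lemma dist_powR_bounds (x a a' e e0 L : R) n :
  0 < a -> 0 < a' -> `|ln a| <= L -> `|ln a'| <= L -> `|e| <= e0 ->
  a * scale lam n < x <= a' * scale lam n ->
  expR (- (e0 * L)) * expR (- (lam * (n%:R * e))) <= x `^ e <=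
  expR (e0 * L) * expR (- (lam * (n%:R * e))).
Proof.
move=> a0 a'0 La La' ee /andP[ax xa']; have s0 := scale_gt0 lam n.
have x0 : 0 < x by apply: lt_trans ax; rewrite mulr_gt0.
pose y := ln x + lam * n%:R.
have yL : `|y| <= L.
  have hl : ln a - lam * n%:R <= ln x.
    have <- : ln (a * scale lam n) = ln a - lam * n%:R.
      by rewrite lnM ?posrE// expRK.
    by rewrite ler_ln ?posrE ?mulr_gt0// ltW.
  have hr : ln x <= ln a' - lam * n%:R.
    have <- : ln (a' * scale lam n) = ln a' - lam * n%:R.
      by rewrite lnM ?posrE// expRK.
    by rewrite ler_ln ?posrE ?mulr_gt0.
  move: La La'; rewrite !ler_norml => /andP[l1 _] /andP[_ l2].
  rewrite /y; apply/andP; split.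
    by rewrite -lerBlDr (le_trans _ hl)// lerD2r.
  by rewrite -lerBrDr (le_trans hr)// lerD2r.
have ey : `|e * y| <= e0 * L by rewrite normrM ler_pM.
have -> : x `^ e = expR (e * y) * expR (- (lam * (n%:R * e))).
  rewrite -expRD /powR gt_eqF//; congr expR; rewrite /y; ring.
move: ey; rewrite ler_norml => /andP[e1 e2].
by rewrite !ler_pM2r ?expR_gt0// !ler_expR e1 e2.
Qed.

(** The constant is chosen before the levels and b, so it serves for all flags of all lengths. *)
Lemma integrand_bounds (a a' : R) : 0 < a -> 0 < a' -> forall bmax : R,
  exists2 K, 0 < K & forall (n : 'I_N -> 'I_N -> nat) b p, `|b| <= bmax ->
   config_set lam n a a' p ->
   K^-1 * expR (- (lam * \sum_(i < N) \sum_(j < N | (i < j)%N) (n i j)%:R * (2 * c i j * b)))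
     <= integrand b p <=
   K * expR (- (lam * \sum_(i < N) \sum_(j < N | (i < j)%N) (n i j)%:R * (2 * c i j * b))).
Proof.
move=> a0 a'0 bmax; pose L := `|ln a| + `|ln a'|.
pose e0 i j := `|2 * c i j| * bmax.
exists (\prod_(i < N) \prod_(j < N | (i < j)%N) expR (e0 i j * L)).
  by apply: prodr_gt0 => i _; apply: prodr_gt0 => j _; exact: expR_gt0.
move=> n b p bb [_ pD].
have E : expR (- (lam * \sum_(i < N) \sum_(j < N | (i < j)%N) (n i j)%:R * (2 * c i j * b)))
  = \prod_(i < N) \prod_(j < N | (i < j)%N) expR (- (lam * ((n i j)%:R * (2 * c i j * b)))).
  rewrite mulr_sumr -sumrN expR_sum; apply: eq_bigr => i _.
  by rewrite mulr_sumr -sumrN expR_sum.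
have bnd (i j : 'I_N) : (i < j)%N ->
    expR (- (e0 i j * L)) * expR (- (lam * ((n i j)%:R * (2 * c i j * b)))) <=
    chordal_dist (tnth p i) (tnth p j) `^ (2 * c i j * b) <=
    expR (e0 i j * L) * expR (- (lam * ((n i j)%:R * (2 * c i j * b)))).
  move=> ij; apply: (dist_powR_bounds a0 a'0) => //; last exact: pD.
  - by rewrite lerDl.
  - by rewrite lerDr.
  - by rewrite normrM ler_wpM2l.
rewrite E -!prodfV; apply/andP; split.
  rewrite -big_split /=; apply: ler_prod => i _; apply/andP; split.
    by rewrite mulr_ge0 ?invr_ge0// prodr_ge0// => j _; exact: expR_ge0.
  rewrite -prodfV -big_split /=; apply: ler_prod => j ij.
  by rewrite -expRN mulr_ge0 ?expR_ge0//; have /andP[] := bnd i j ij.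
rewrite -big_split /=; apply: ler_prod => i _; apply/andP; split.
  by apply: prodr_ge0 => j _; exact: powR_ge0.
rewrite -big_split /=; apply: ler_prod => j ij.
by rewrite powR_ge0; have /andP[] := bnd i j ij.
Qed.

(** The value of the integrand times the mass of the configurations, both up to constants, is the
    product of the weights along the flag. *)
Lemma flag_weightE b M E s : s \in flags M E ->
  expR (- (lam * \sum_(i < N) \sum_(j < N | (i < j)%N)
                   (level s i j)%:R * (2 * c i j * b))) *
  \prod_(j < N) scale lam (top_level (level s) j) ^+ 2 =
  \prod_(E' <- s) weight c lam b E'.
Proof.
move=> sf.
have -> : \prod_(j < N) scale lam (top_level (level s) j) ^+ 2 =
    expR (- (lam * (2 * (\sum_(E' <- s) rank_equiv E')%:R))).
  rewrite (flag_rankE sf) natr_sum !mulr_sumr -sumrN expR_sum.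
  apply: eq_bigr => j _; rewrite /scale -expRM_natl; congr expR.
  by rewrite /top_level; ring.
rewrite -expRD -expR_sum; congr expR.
rewrite sum_levelE natr_sum -opprD -mulrDr mulr_sumr -big_split /=.
by rewrite mulr_sumr -sumrN; apply: eq_bigr => E' _; rewrite /energy addrC.
Qed.

End integrand.

(** * Bounds on the partition function *)

Section partition_bounds.
Context {R : realType}.
Variable mu : probability (3.-tuple R) R.
Hypothesis mu_inv : invariant_sphere_probability mu.
Variables (N : nat) (c : 'I_N -> 'I_N -> R).
Hypothesis N_gt0 : (0 < N)%N.

Local Notation sphere_tuples :=
  [set p : N.-tuple (3.-tuple R) | forall i, unit_sphere (tnth p i)].
Local Notation full := [set: 'I_N * 'I_N]%SET.

Lemma config_set_level_inj (lam : R) M s s' t : 0 < lam ->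
  s \in flags M full -> s' \in flags M full ->
  config_set lam (level s) (scale lam 1) 1 t ->
  config_set lam (level s') (scale lam 1) 1 t -> s = s'.
Proof.
move=> lam0 sf sf' [_ h] [_ h'].
have lt_level (x y : nat) (d : R) : scale lam 1 * scale lam x < d <= 1 * scale lam x ->
    scale lam 1 * scale lam y < d <= 1 * scale lam y -> (x <= y)%N.
  rewrite -!scaleS !mul1r => /andP[_ dx] /andP[yd _]; rewrite leqNgt; apply/negP => xy.
  have := lt_le_trans yd dx; rewrite ltNge => /negP; apply.
  exact: scale_mono.
have eq_lt (i j : 'I_N) : (i < j)%N -> level s i j = level s' i j.
  move=> ij; apply/eqP; rewrite eqn_leq.
  by rewrite (lt_level _ _ _ (h _ _ ij) (h' _ _ ij)) (lt_level _ _ _ (h' _ _ ij) (h _ _ ij)).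
apply: (level_inj sf sf') => i j; case: (ltngtP i j) => [|ji|/val_inj ->].
- exact: eq_lt.
- by rewrite (level_sym _ _ sf) (level_sym _ _ sf') eq_lt.
- by rewrite (level_refl _ sf) (level_refl _ sf').
Qed.

Lemma sphere_mass_regular : exists Cu cl : R, [/\ 0 < Cu, 0 < cl,
  forall p r, unit_sphere p -> 0 < r ->
    fine (mu (chordal_ball p r)) <= Cu * r ^+ 2 &
  forall p r, unit_sphere p -> 0 < r -> r <= 1 ->
    cl * r ^+ 2 <= fine (mu (chordal_ball p r))].
Proof.
exists 144, (54 * 7 ^+ 2)^-1; split=> //.
- by move=> p r; exact: ball_mass_upper.
- by move=> p r hp r0 r1; rewrite mulrC; exact: ball_mass_lower.
Qed.

(** Distinct flags have disjoint configuration sets, each of mass bounded below; the scale ratio has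
    to be small for the placement of points to succeed. *)
Lemma partition_lower (bmax : R) : exists lam C : R, [/\ 0 < lam, 0 < C &
  forall b M, `|b| <= bmax ->
    ((C * flag_sum (weight c lam b) M full)%:E <= partition_function mu c b)%E].
Proof.
have [Cu [cl [Cu0 cl0 up lo]]] := sphere_mass_regular.
have N0 : 0 < N%:R :> R by rewrite ltr0n.
pose gam : R := N%:R^-1.
have gam0 : 0 < gam by rewrite invr_gt0.
have gam1 : gam <= 1 by rewrite invf_le1// (ler_nat R 1).
pose h := cl * gam ^+ 2 / 2.
have h0 : 0 < h by rewrite divr_gt0// mulr_gt0// exprn_gt0.
pose kap := Num.min 1 h.
have kap0 : 0 < kap by rewrite lt_min ltr01 h0.
have kap1 : kap <= 1 by rewrite ge_min lexx.
pose del := Num.min 1 (h / (N%:R * Cu)).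
have del0 : 0 < del by rewrite lt_min ltr01 divr_gt0// mulr_gt0.
have del1 : del <= 1 by rewrite ge_min lexx.
have room : kap + N%:R * (Cu * del ^+ 2) <= cl * gam ^+ 2.
  have -> : cl * gam ^+ 2 = h + h by exact: splitr.
  apply: lerD; first by rewrite ge_min lexx orbT.
  rewrite mulrA mulrC -ler_pdivlMr ?mulr_gt0//.
  apply: (@le_trans _ _ del); last by rewrite ge_min lexx orbT.
  by rewrite expr2 ler_piMr// ltW.
(* With gam = 1/N and scale 1 = del/2, the window of [config_set_lower] for N points becomes exactly
   from [scale 1] to 1. *)
pose lam := - ln (del / 2).
have d20 : 0 < del / 2 by rewrite divr_gt0.
have lam0 : 0 < lam.
  rewrite oppr_gt0 ln_lt0// d20 /= ltr_pdivrMr// mul1r.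
  by rewrite (le_lt_trans del1)// (ltr_nat R 1).
have sc1 : scale lam 1 = del / 2 by rewrite /scale mulr1 opprK lnK ?posrE.
have [K K0 HK] := integrand_bounds c lam (scale_gt0 lam 1) (@ltr01 R) bmax.
exists lam, (K^-1 * kap ^+ N); split=> //; first by rewrite mulr_gt0 ?invr_gt0 ?exprn_gt0.
move=> b M bb.
pose v (s : seq {set 'I_N * 'I_N}) := K^-1 * expR (- (lam * \sum_(i < N) \sum_(j < N | (i < j)%N)
                   (level s i j)%:R * (2 * c i j * b))).
have v0 s : 0 <= v s by rewrite mulr_ge0 ?invr_ge0 ?expR_ge0 ?ltW.
pose X (s : seq {set 'I_N * 'I_N}) := config_set lam (level s) (scale lam 1) 1.
have mX s : measurable (X s) by exact: measurable_config_set.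
have mD := @measurable_sphere_tuples R N.
have mf : measurable_fun sphere_tuples (integrand c b).
  by apply: measurable_funTS; exact: measurable_integrand.
have := @sum_le_integral _ _ R (product_power mu N) sphere_tuples mD _
  (flags M full) X v mX v0 (integrand c b) mf.
move=> H; apply: le_trans (H _); last first.
  move=> t tS; apply: sum_indic_le.
  - exact: flags_uniq.
  - exact: integrand_ge0.
  - by move=> s s' sf sf'; exact: (config_set_level_inj lam0 sf sf').
  - by move=> s sf /(HK (level s) b t bb)/andP[].
rewrite flag_sumE mulr_sumr -sumEFin big_seq [leRHS]big_seq; apply: lee_sum => s sf.
have XD : X s `&` sphere_tuples = X s by apply/setIidPl => t [].
rewrite XD -(flag_weightE c lam b sf).
set w := expR _; set p := \prod_(j < N) _.
have -> : K^-1 * kap ^+ N * (w * p) = v s * (kap ^+ N * p) by rewrite /v -/w; ring.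
rewrite EFinM lee_wpmul2l ?lee_fin//.
have := @config_set_lower R mu mu_inv Cu cl Cu0 up lo lam lam0 N gam del kap gam0 gam1
  del0 (ltW kap0) kap1 room N (level s) (leqnn N) (fun i j => level_sym i j sf)
  (fun i j k => level_ultrametric i j k sf).
rewrite big_split /= prodr_const card_ord -/p.
have -> : N%:R * gam = 1 by rewrite divff// gt_eqF.
have -> // : del - N%:R * (gam * scale lam 1) = scale lam 1.
rewrite mulrA divff ?gt_eqF// mul1r sc1; clear; lra.
Qed.

Section upper.
Variable lam : R.
Hypothesis lam0 : 0 < lam.

(** With all levels 0 the upper bound 2 is automatic, and only the separation remains. *)
Definition separated_set (M : nat) : set (N.-tuple (3.-tuple R)) :=
  config_set lam (fun _ _ => 0%N) (2 * scale lam M.+1) 2.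

Lemma separated_setP M t : separated_set M t <->
  (forall i, unit_sphere (tnth t i)) /\ forall i j : 'I_N, (i < j)%N ->
     2 * scale lam M.+1 < chordal_dist (tnth t i) (tnth t j).
Proof.
split=> -[tS h]; split=> // i j ij; first by have := h i j ij; rewrite scale0 mulr1 => /andP[].
rewrite scale0 !mulr1 h//=; exact: chordal_sphere_le2.
Qed.

Lemma scale_arbitrarily_small (x K : R) : 0 <= x -> 0 < K ->
  (forall M, x <= K * scale lam M) -> x = 0.
Proof.
move=> x0 K0 h; apply/eqP; rewrite eq_le x0 andbT leNgt; apply/negP => xp.
pose M := archimedean.Num.bound (K / (lam * x)).
have : K / (lam * x) < M%:R.
  by apply: archimedean.Num.Theory.archi_boundP; rewrite divr_ge0 ?mulr_ge0 ?ltW.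
rewrite ltr_pdivrMr ?mulr_gt0// => hM.
have := h M; rewrite leNgt => /negP; apply.
rewrite /scale expRN ltr_pdivrMr ?expR_gt0//.
apply: (@lt_le_trans _ _ (x * (1 + lam * M%:R))).
  rewrite mulrDr mulr1; apply: (lt_trans hM).
  by rewrite (_ : x * (lam * M%:R) = M%:R * (lam * x)) ?ltrDr//; ring.
by rewrite ler_wpM2l ?expR_ge1Dx.
Qed.

(** Outside [separated_set M] some pair is within 2 q^M. Prescribing level M for that pair only,
    [config_set_upper] bounds the mass by a constant times q^M, and M is arbitrary. *)
Lemma coincidence_null :
  product_power mu N (sphere_tuples `\` \bigcup_M separated_set M) = 0%E.
Proof.
have [Cu [cl [Cu0 cl0 up lo]]] := sphere_mass_regular.
set Z0 := _ `\` _.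
have mZ0 : measurable Z0.
  apply: measurableD; first exact: measurable_sphere_tuples.
  by apply: bigcupT_measurable => M; exact: measurable_config_set.
pose n M (ij : 'I_N * 'I_N) k l := if (k == ij.1) && (l == ij.2) then M else 0%N.
pose X M (ij : 'I_N * 'I_N) : set (N.-tuple (3.-tuple R)) :=
  if (ij.1 < ij.2)%N then config_set lam (n M ij) (-1) 2 else set0.
have mX M ij : measurable (X M ij).
  by rewrite /X; case: ifP => // _; exact: measurable_config_set.
pose Cc : R := 1 + Cu * 2 ^+ 2.
have Cc0 : 0 < Cc by rewrite addr_gt0// mulr_gt0// exprn_gt0.
have PX M ij : (product_power mu N (X M ij `&` Z0) <= (Cc ^+ N * scale lam M)%:E)%E.
  apply: (@le_trans _ _ (product_power mu N (X M ij))).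
    by apply: le_measure; rewrite ?inE//; exact: measurableI.
  rewrite /X; case: ifP => ij12; last first.
    by rewrite measure0 lee_fin mulr_ge0 ?exprn_ge0 ?(ltW Cc0) ?(ltW (scale_gt0 _ _)).
  apply: le_trans (config_set_upper Cu0 up lam _ _ (ltr0Sn R 1)) _.
  rewrite lee_fin big_split /= prodr_const card_ord -/Cc ler_wpM2l ?exprn_ge0 ?(ltW Cc0)//.
  rewrite (bigD1 ij.1) //= -[leRHS]mulr1; apply: ler_pM.
  - exact: sqr_ge0.
  - by apply: prodr_ge0 => k _; exact: sqr_ge0.
  - apply: (@le_trans _ _ (scale lam (top_level (n M ij) ij.1))).
      by rewrite expr2 ler_piMr ?scale_le1 ?(ltW (scale_gt0 _ _)).
    apply: scale_mono => //; rewrite /top_level (bigop.bigmax_sup ij.2)//.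
    by rewrite /n !eqxx.
  - apply: prodr_ile1 => k _.
    by rewrite sqr_ge0 expr_le1 ?scale_le1 ?(ltW (scale_gt0 _ _)).
have bound M : fine (product_power mu N Z0) <=
    (#|{: 'I_N * 'I_N}|%:R * Cc ^+ N + 1) * scale lam M.
  have := @integral_le_sum _ _ R (product_power mu N) Z0 mZ0 _ (enum {: 'I_N * 'I_N})
    (X M) (fun=> 1) (mX M) (fun=> ler01) (fun=> 1) (measurable_cst _).
  rewrite integral_cst// mul1e => H.
  rewrite -lee_fin fineK ?fin_num_measure//; apply: le_trans (H _ _) _ => //.
    move=> t [tS nt].
    have [i [j [ij dij]]] : exists i j : 'I_N, (i < j)%N /\
        chordal_dist (tnth t i) (tnth t j) <= 2 * scale lam M.+1.
      apply: contrapT => no; apply: nt; exists M => //; apply/separated_setP.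
      split=> // i j ij; rewrite ltNge; apply/negP => d; apply: no.
      by exists i, j.
    apply: (le_sum_indic (i := (i, j))) => //; first by rewrite mem_enum.
    rewrite /X /= ij; split=> // k l kl; apply/andP; split.
      rewrite (lt_le_trans _ (chordal_ge0 _ _))// mulN1r oppr_lt0.
      exact: scale_gt0.
    rewrite /n /=; case: ifP => [/andP[/eqP -> /eqP ->]|_].
      by rewrite (le_trans dij)// ler_pM2l// scale_mono.
    by rewrite scale0 mulr1 chordal_sphere_le2.
  apply: (@le_trans _ _ (\sum_(ij <- enum {: 'I_N * 'I_N}) (Cc ^+ N * scale lam M)%:E)%E).
    by apply: lee_sum => ij _; rewrite mul1e; exact: PX.
  rewrite sumEFin big_enum sumr_const lee_fin mulrDl mul1r -[leLHS]mulr_natl mulrA.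
  by rewrite lerDl ltW// scale_gt0.
have fin : product_power mu N Z0 = (fine (product_power mu N Z0))%:E.
  by rewrite fineK// fin_num_measure.
rewrite fin; congr (_%:E).
apply: scale_arbitrarily_small bound; first by rewrite fine_ge0.
by rewrite ltr_wpDl// mulr_ge0// exprn_ge0// ltW.
Qed.

(** On [separated_set M] the flags of length M cover, with a constant independent of M. These sets
    increase to almost the whole domain, so monotone convergence concludes. *)
Lemma partition_upper (bmax : R) : exists2 C : R, 0 < C &
  forall b B, `|b| <= bmax ->
    (forall M, flag_sum (weight c lam b) M full <= B) ->
    (partition_function mu c b <= (C * B)%:E)%E.
Proof.
have [Cu [cl [Cu0 cl0 up lo]]] := sphere_mass_regular.
have a0 : 0 < 2 * scale lam 1 by rewrite mulr_gt0 ?scale_gt0.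
have a'0 : 0 < 2 * N%:R :> R by rewrite mulr_gt0 ?ltr0n.
have [K K0 HK] := integrand_bounds c lam a0 a'0 bmax.
pose Cc : R := 1 + Cu * (2 * N%:R) ^+ 2.
have Cc0 : 0 < Cc by rewrite addr_gt0// mulr_gt0// exprn_gt0.
exists (K * Cc ^+ N); first by rewrite mulr_gt0 ?exprn_gt0.
move=> b B bb hB.
have mD := @measurable_sphere_tuples R N.
have mS M : measurable (separated_set M) by exact: measurable_config_set.
have mf E : measurable_fun E (fun p => (integrand c b p)%:E).
  by apply/measurable_EFinP; apply: measurable_funTS; exact: measurable_integrand.
have step M : (\int[product_power mu N]_(p in separated_set M) (integrand c b p)%:E
    <= (K * Cc ^+ N * B)%:E)%E.
  pose v (s : seq {set 'I_N * 'I_N}) := K * expR (- (lam * \sum_(i < N) \sum_(j < N | (i < j)%N)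
                   (level s i j)%:R * (2 * c i j * b))).
  have v0 s : 0 <= v s by rewrite mulr_ge0 ?expR_ge0 ?ltW.
  pose X (s : seq {set 'I_N * 'I_N}) := config_set lam (level s) (2 * scale lam 1) (2 * N%:R).
  have mX s : measurable (X s) by exact: measurable_config_set.
  have mfM : measurable_fun (separated_set M) (integrand c b).
    by apply: measurable_funTS; exact: measurable_integrand.
  have H := @integral_le_sum _ _ R (product_power mu N) (separated_set M) (mS M) _
    (flags M full) X v mX v0 (integrand c b) mfM (fun p _ => integrand_ge0 c b p).
  apply: le_trans (H _) _ => {H}.
    move=> t /separated_setP[tS tD].
    have [s sf ts] := flag_covering lam0 tS tD.
    apply: (le_sum_indic (i := s)) => //.
    by have /andP[] := HK (level s) b t bb ts.
  apply: (@le_trans _ _ ((K * Cc ^+ N * flag_sum (weight c lam b) M full)%:E)); last first.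
    by rewrite lee_fin ler_wpM2l// mulr_ge0 ?exprn_ge0 ?(ltW K0) ?(ltW Cc0).
  rewrite flag_sumE mulr_sumr -sumEFin big_seq [leRHS]big_seq; apply: lee_sum => s sf.
  rewrite -(flag_weightE c lam b sf); set w := expR _; set p := \prod_(j < N) _.
  have -> : K * Cc ^+ N * (w * p) = v s * (Cc ^+ N * p) by rewrite /v -/w; ring.
  rewrite [X in (_ <= X)%E]EFinM lee_wpmul2l ?lee_fin//.
  apply: (@le_trans _ _ (product_power mu N (X s))).
    by apply: le_measure; rewrite ?inE//; exact: measurableI.
  apply: le_trans (config_set_upper Cu0 up lam _ _ a'0) _.
  by rewrite big_split /= prodr_const card_ord.
rewrite /partition_function -/(integrand c b).
have mU : measurable (\bigcup_M separated_set M) by exact: bigcupT_measurable.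
have mZ : measurable (sphere_tuples `\` \bigcup_M separated_set M) by exact: measurableD.
rewrite (ge0_negligible_integral mZ mD (mf _) _ coincidence_null); last first.
  by move=> p _; rewrite lee_fin integrand_ge0.
rewrite setDD setIC.
have -> : \bigcup_M separated_set M `&` sphere_tuples = \bigcup_M separated_set M.
  by apply/setIidPl => t [M _ []].
have ndS : nondecreasing_seq separated_set.
  move=> m m' mm; apply/subsetPset => t /separated_setP[tS tD].
  apply/separated_setP; split=> // i j ij; apply: le_lt_trans (tD _ _ ij).
  by rewrite ler_pM2l// scale_mono.
have cv := ge0_nondecreasing_set_cvg_integral (mu := product_power mu N)
  (f := fun p => (integrand c b p)%:E) ndS mS (fun M => mf _) (fun M p _ => _).
rewrite -(cvg_lim _ (cv _))//; last by move=> *; rewrite lee_fin integrand_ge0.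
apply: lime_le; last by apply: nearW.
apply/cvg_ex; eexists; apply: cv => *; rewrite lee_fin; exact: integrand_ge0.
Qed.

End upper.

End partition_bounds.

(** * Critical asymptotics *)

Section critical_asymptotics.
Context {R : realType}.
Variable mu : probability (3.-tuple R) R.
Hypothesis mu_inv : invariant_sphere_probability mu.
Variables (N : nat) (c : 'I_N -> 'I_N -> R).
Hypothesis N_gt0 : (0 < N)%N.
Hypothesis T_gt0 : 0 < T_plus c.

(** The two bounds use different scale ratios, which affects only the constants. The lower bound
    starts from a nest of maximal size, the upper one from the full relation. *)
Lemma partition_function_asymptotics : exists c1 c2 : R, [/\ 0 < c1, 0 < c2 &
  forall b, (2 * T_plus c)^-1 <= b -> b * T_plus c < 1 ->
    ((c1 * (1 - b * T_plus c) ^- kappa_plus c)%:E <= partition_function mu c b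
     <= (c2 * (1 - b * T_plus c) ^- kappa_plus c)%:E)%E].
Proof.
set b0 := (2 * T_plus c)^-1; have b0_gt0 : 0 < b0 by rewrite invr_gt0 mulr_gt0.
pose bmax := (T_plus c)^-1.
have b_le b : b0 <= b -> b * T_plus c < 1 -> `|b| <= bmax.
  move=> b0b bT; rewrite ger0_norm; last exact/ltW/(lt_le_trans b0_gt0).
  by rewrite /bmax -[leRHS]mul1r ler_pdivlMr// ltW.
have [lam [C [lam0 C0 HC]]] := partition_lower mu_inv c N_gt0 bmax.
have [K [KG nK] cK] : exists2 K : {set {set 'I_N}},
    K \subset G_plus c /\ nest K & #|K| = kappa_plus c.
  have : (0 < #|[pred K : {set {set 'I_N}} | (K \subset G_plus c) && nest K]|)%N.
    apply/card_gt0P; exists finset.set0; rewrite inE finset.sub0set /=.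
    by apply/nestP => S S'; rewrite inE.
  move=> /(bigop.eq_bigmax_cond (fun K : {set {set 'I_N}} => #|K|))[K].
  by rewrite inE => /andP[KG nK] mK; exists K.
have [C1 C10 HC1] := flag_sum_lower b0_gt0 T_gt0 lam0 KG nK.
have [C2 C20 HC2] := partition_upper mu_inv c N_gt0 (@ltr01 R) bmax.
have [C3 C30 HC3] := flag_sum_upper b0_gt0 T_gt0 (@ltr01 R) (is_equiv_setT N).
exists (C * C1), (C2 * C3); split; rewrite ?mulr_gt0// => b b0b bT.
apply/andP; split.
  have [M HM] := HC1 b b0b bT.
  apply: le_trans (HC b M (b_le _ b0b bT)); rewrite lee_fin -mulrA ler_pM2l//.
  rewrite -cK; apply: le_trans HM _; apply: flag_sum_mono.
    by move=> E; exact: weight_ge0.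
  exact: finset.subsetT.
apply: le_trans (HC2 b (C3 * (1 - b * T_plus c) ^- kappa_plus c) (b_le _ b0b bT) _) _.
  move=> M; apply: le_trans (HC3 b M b0b bT) _; rewrite ler_pM2l//.
  apply: (eps_expV_mono b0_gt0 T_gt0 b0b bT); exact: nest_depth_max.
by rewrite mulrA.
Qed.

Lemma log_partition_function_asymptotics : exists A : R,
  forall b, (2 * T_plus c)^-1 <= b -> b * T_plus c < 1 ->
  `| - (N%:R^-1 * ln (fine (partition_function mu c b))) -
     (kappa_plus c)%:R / N%:R * ln `|b - (T_plus c)^-1| | <= A.
Proof.
have [c1 [c2 [c10 c20 H]]] := partition_function_asymptotics.
set k := kappa_plus c in H *; set T := T_plus c in H *; have T0 : 0 < T := T_gt0.
exists (N%:R^-1 * (`|ln c1| + `|ln c2| + k%:R * `|ln T|)) => b b0b bT.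
have /andP[Z1 Z2] := H b b0b bT.
have e0 : 0 < 1 - b * T by rewrite subr_gt0.
set eps := 1 - b * T in Z1 Z2 e0.
have ek0 : 0 < eps ^- k by rewrite invr_gt0 exprn_gt0.
(* The upper bound makes Z finite, so that [fine] returns its true value. *)
have ZE : partition_function mu c b = (fine (partition_function mu c b))%:E.
  rewrite fineK// ge0_fin_numE; first exact: le_lt_trans Z2 (ltry _).
  by apply: le_trans Z1; rewrite lee_fin ltW// mulr_gt0.
move: Z1 Z2; rewrite ZE !lee_fin; set Z := fine _ => Z1 Z2.
have Z0 : 0 < Z by apply: lt_le_trans Z1; rewrite mulr_gt0.
have lnE x : 0 < x -> ln (x * eps ^- k) = ln x - k%:R * ln eps.
  by move=> x0; rewrite lnM ?posrE// lnV ?posrE ?exprn_gt0// lnXn// mulr_natl.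
have L1 : ln c1 - k%:R * ln eps <= ln Z by rewrite -lnE// ler_ln ?posrE ?mulr_gt0.
have L2 : ln Z <= ln c2 - k%:R * ln eps by rewrite -lnE// ler_ln ?posrE ?mulr_gt0.
have -> : `|b - T^-1| = eps / T.
  have -> : b - T^-1 = - (eps / T) by rewrite /eps; field; rewrite gt_eqF.
  by rewrite normrN ger0_norm// divr_ge0// ltW.
rewrite lnM ?posrE ?invr_gt0// lnV ?posrE//.
have -> : - (N%:R^-1 * ln Z) - k%:R / N%:R * (ln eps - ln T) =
  N%:R^-1 * (- (ln Z + k%:R * ln eps) + k%:R * ln T) by ring.
rewrite normrM ger0_norm ?invr_ge0// ler_wpM2l ?invr_ge0//.
rewrite (le_trans (ler_normD _ _))// lerD//; last by rewrite normrM ger0_norm.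
rewrite normrN ler_norml; apply/andP; split.
  have : - `|ln c1| <= ln c1 by rewrite lerNl -normrN ler_norm.
  have : 0 <= `|ln c2| by [].
  by move: L1; clear; lra.
have : ln c2 <= `|ln c2| by exact: ler_norm.
have : 0 <= `|ln c1| by [].
by move: L2; clear; lra.
Qed.

End critical_asymptotics.

(** * Exchange of the two critical temperatures under a change of sign of c and b *)

Section sign_symmetry.
Context {R : realType} {N : nat}.
Variable c : 'I_N -> 'I_N -> R.
Local Notation oc := (fun i j => - c i j).

Lemma interaction_ratio_opp (S : {set 'I_N}) :
  interaction_ratio oc S = - interaction_ratio c S.
Proof.
rewrite /interaction_ratio -mulNr; congr (_ / _).
by rewrite -sumrN; apply: eq_bigr => i _; rewrite -sumrN.
Qed.

Lemma min_ratio_opp : min_ratio oc = - max_ratio c.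
Proof.
rewrite /min_ratio /max_ratio (big_morph -%R (@oppr_max _) (erefl _)).
rewrite interaction_ratio_opp; apply: eq_bigr => S _.
exact: interaction_ratio_opp.
Qed.

Lemma T_plus_opp : T_plus oc = - T_minus c.
Proof. by rewrite /T_plus /T_minus min_ratio_opp. Qed.

Lemma kappa_plus_opp : kappa_plus oc = kappa_minus c.
Proof.
rewrite /kappa_plus /kappa_minus; congr max_nest_size; apply/setP => S.
by rewrite !inE interaction_ratio_opp min_ratio_opp eqr_opp.
Qed.

Lemma partition_function_opp mu b :
  partition_function mu oc (- b) = partition_function mu c b.
Proof.
apply: eq_integral => p _; congr (_%:E).
by apply: eq_bigr => i _; apply: eq_bigr => j _; rewrite !mulrN mulNr opprK.
Qed.

End sign_symmetry.

Theorem theorem1p6 (R : realType) (mu : probability (3.-tuple R) R)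
    (N : nat) (c : 'I_N -> 'I_N -> R) :
  invariant_sphere_probability mu -> (2 <= N)%N ->
  let Z := partition_function mu c in
  let D := [set b : R | (beta_minus c < b%:E < beta_plus c)%E] in
  (forall bc : R, beta_plus c = bc%:E ->
     (fun b : R => - (N%:R^-1 * ln (fine (Z b)))) =
     (fun b : R => (kappa_plus c)%:R / N%:R * ln `|b - bc|)
       +O_ (within D (nbhs bc)) (fun=> 1 : R)) /\
  (forall bc : R, beta_minus c = bc%:E ->
     (fun b : R => - (N%:R^-1 * ln (fine (Z b)))) =
     (fun b : R => (kappa_minus c)%:R / N%:R * ln `|b - bc|)
       +O_ (within D (nbhs bc)) (fun=> 1 : R)).
Proof.
move=> mu_inv N2 Z D; have N0 : (0 < N)%N by exact: ltnW.
(* The estimates hold for b at least half the critical value, hence near it. *)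
have half (T : R) : 0 < T -> (2 * T)^-1 < T^-1.
  by move=> T0; rewrite ltf_pV2 ?posrE ?mulr_gt0// ltr_pMl// (ltr_nat R 1).
split=> bc.
  rewrite /beta_plus; case: ifPn => // T0 [bcE].
  have [A HA] := log_partition_function_asymptotics mu_inv N0 T0.
  apply/eqaddOP; near=> k.
  have Ak : A <= k by near: k; apply: nbhs_pinfty_ge; rewrite num_real.
  rewrite near_withinE; near=> b => -[/andP[_ bD]].
  rewrite /= normr1 mulr1 -bcE; apply: le_trans (HA b _ _) Ak.
    by near: b; apply: lt_le_nbhsr; rewrite -bcE; exact: half.
  by move: bD; rewrite /beta_plus T0 lte_fin -[_^-1]mul1r ltr_pdivlMr.
rewrite /beta_minus; case: ifPn => // T0 [bcE].
have oT0 : 0 < T_plus (fun i j => - c i j) by rewrite T_plus_opp oppr_gt0.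
have [A HA] := log_partition_function_asymptotics mu_inv N0 oT0.
apply/eqaddOP; near=> k.
have Ak : A <= k by near: k; apply: nbhs_pinfty_ge; rewrite num_real.
rewrite near_withinE; near=> b => -[/andP[bD _]].
rewrite /= normr1 mulr1 -bcE; apply: le_trans _ Ak.
(* The estimate for -c at the point -b is the one for c at b. *)
have := HA (- b); rewrite partition_function_opp kappa_plus_opp T_plus_opp.
have -> : `|- b - (- T_minus c)^-1| = `|b - (T_minus c)^-1|.
  by rewrite invrN -opprD normrN.
rewrite mulrNN => h; apply: h.
  rewrite mulrN invrN lerN2; near: b; apply: lt_le_nbhsl; rewrite -bcE.
  have := half (- T_minus c); rewrite oppr_gt0 mulrN !invrN ltrN2; exact.
by move: bD; rewrite /beta_minus T0 lte_fin -[_^-1]mul1r ltr_ndivrMr.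
Unshelve. all: by end_near. Qed.
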